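(* Let $n\ge 1$, let $\lambda$ be an $n$-partition, let $\sigma\in S_n^\lambda$, and let $T$ be a semistandard tableau of shape $\lambda$. Then $Y_\lambda(\sigma)\le L(T)$ if and only if $T(l,k)\in F_\lambda(T,\sigma;l,k)$ for all $(l,k)\in\lambda$; and $Y_\lambda(\sigma)=L(T)$ if and only if $T(l,k)\in G_\lambda(T,\sigma;l,k)$ for all $(l,k)\in\lambda$.
   Context: Notation. Fix $n\ge 1$. For integers $p,q$, $[p,q]=\{p,p+1,\dots,q\}$ (empty if $p>q$). An $n$-partition is $\lambda=(\lambda_1\ge\dots\ge\lambda_n\ge 0)$, integers. Its shape has $\lambda_i$ left-justified boxes in row $i$ (row 1 at the top). The box in column $j$ and row $i$ is written $(j,i)\in\lambda$ (column index first). The column lengths are $\zeta_1,\dots,\zeta_{\lambda_1}$. A semistandard tableau $T$ of shape $\lambda$ is a filling with values $T(j,i)\in[1,n]$ such that $T(j,i)\le T(j+1,i)$ and $T(j,i)<T(j,i+1)$; $\mathcal{T}_\lambda$ is the set of these. Boundary convention: $T(l,k+1):=n+1$ if $k=\zeta_l$. For tableaux of the same shape, $T\le U$ means $T(j,i)\le U(j,i)$ for all boxes. Permutations and keys. $S_n$ is the set of $n$-tuples $\sigma=(\sigma_1,\dots,\sigma_n)$ with distinct entries from $[1,n]$. Let $q_1<\dots<q_r$ be the distinct column lengths of $\lambda$, $q_0:=0$, $q_{r+1}:=n$. $S_n^\lambda$ is the set of $\sigma\in S_n$ such that $\sigma_i<\sigma_j$ whenever $i<j$ both lie in $[q_{s-1}+1,q_s]$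 for some $1\le s\le r+1$. The $\lambda$-key $Y=Y_\lambda(\sigma)$ is the tableau of shape $\lambda$ whose $j$th column consists of $\sigma_1,\dots,\sigma_{\zeta_j}$ sorted increasingly from top to bottom, with entries $Y(j,i)$. Left key. For $T\in\mathcal{T}_\lambda$ and each $j$, there is a semistandard skew tableau that rectifies (by jeu de taquin) to $T$, whose column lengths are a rearrangement of $\zeta_1,\dots,\zeta_{\lambda_1}$, and whose leftmost column has length $\zeta_j$; the leftmost column depends only on $T$ and its length $\zeta_j$. The left key $L(T)\in\mathcal{T}_\lambda$ is the tableau whose $j$th column is this leftmost column. Left scanning. Given a tableau $X$ (a filling of a shape, semistandard) and a location $(l,k)$ of $X$, the maximizing weakly decreasing sequence (MWDS) from $(l,k)$ in $X$ starts with $X(l,k)$ and then successively, for columns $l-1,l-2,\dots,1$, takes the maximum value in that column of $X$ that is less than or equal to the most recent value taken; the locations of these values form the left scanning path $N(X;l,k)$ (when each path is formed directly in the indicated tableau $X$ without removals). For $T\in\mathcal{T}_\lambda$ and $1\le l\le\lambda_1$, let $T^{(l,\zeta_l)}$ be $T$ with all columns to the right of column $l$ removed. For $k=\zeta_l,\zeta_l-1,\dots,1$: form in $T^{(l,k)}$ the left scanning path starting at $(l,k)$, and obtain $T^{(l,k-1)}$ from $T^{(l,k)}$ by removing all locations in this path and all locations beneath them in their columns. The sets $F$. For $l=1$, $F_\lambda(T,\sigma;1,k):=[Y(1,k),\,T(1,k+1)-1]$. For $l\ge 2$, let $V=V^{(l,k)}$ be $T^{(l,k)}$ with its rightmost remaining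 column (column $l$) removed. Let $q$ be maximal such that $(l-1,q)$ is a location of $V$ and $V(l-1,q)\le T(l,k+1)-1$. For $k\le h\le q$ form the paths $N(V;l-1,h)$ in $V$ (without removing any path as they are formed) and let $g_h$ be the final value, in the first column, of $N(V;l-1,h)$; one has $g_q\ge g_{q-1}\ge\cdots\ge g_k$. Let $p\in[k,q]$ be minimal such that $g_p\ge Y(l,k)$. If no such $p$ exists, $F_\lambda(T,\sigma;l,k):=\emptyset$; otherwise $F_\lambda(T,\sigma;l,k):=[T(l-1,p),\,T(l,k+1)-1]$. The sets $G$. For $l=1$, $G_\lambda(T,\sigma;1,k):=\{Y(1,k)\}$. For $l\ge2$, with $V,q$ and $g_h$ ($k\le h\le q$) as just defined, let $a$ be minimal and $b$ maximal in $[k,q]$ such that $g_a=Y(l,k)=g_b$. If no such $a,b$ exist, $G_\lambda(T,\sigma;l,k):=\emptyset$; otherwise $G_\lambda(T,\sigma;l,k):=[T(l-1,a),\,\min\{V(l-1,b+1)-1,\,T(l,k+1)-1\}]$, where $V(l-1,b+1):=n+1$ if $(l-1,b+1)$ is not a location of $V$. *)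

(* Defs.v *)
Set Warnings "-notation-overridden".
From mathcomp Require Import all_boot.
From mathcomp Require Import boolp classical_sets.

Set Implicit Arguments.
Unset Strict Implicit.
Unset Printing Implicit Defensive.

(* All indices (rows, columns, entries of tuples) start from 1, and a box is   *)
(* addressed column first.  A filling of a shape is the list of its columns,   *)
(* each listed from top to bottom.                                             *)
Notation tableau := (seq (seq nat)).

Definition nth1 (s : seq nat) (i : nat) : nat := nth 0 s i.-1.

Definition column (T : tableau) (j : nat) : seq nat := nth [::] T j.-1.

Definition is_loc (T : tableau) (j i : nat) : bool :=
  [&& 0 < j, j <= size T, 0 < i & i <= size (column T j)].

Definition entry (T : tableau) (j i : nat) : nat := nth1 (column T j) i.

(* The boundary convention: a location that is missing carries n + 1. *)
Definition entry_or_top (n : nat) (T : tableau) (j i : nat) : nat :=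
  if is_loc T j i then entry T j i else n.+1.

Section Shape.
Variable n : nat.
Implicit Types (lam sigma : n.-tuple nat) (T : tableau).

Definition is_partition lam : bool := sorted geq lam.

Definition in_shape lam (j i : nat) : bool := (0 < i) && (0 < j <= nth1 lam i).

Definition col_length lam (j : nat) : nat := count (fun m => j <= m) lam.

Definition col_lengths lam : seq nat :=
  [seq col_length lam j | j <- iota 1 (nth1 lam 1)].

Definition semistandard_tableau lam T : Prop :=
  [/\ map size T = col_lengths lam,
      forall j i, is_loc T j i -> 1 <= entry T j i <= n,
      forall j i, is_loc T j i -> is_loc T j.+1 i ->
        entry T j i <= entry T j.+1 i
    & forall j i, is_loc T j i -> is_loc T j i.+1 ->
        entry T j i < entry T j i.+1].

(* q_0 < q_1 < ... < q_r <= q_(r+1), numbered from 0. *)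
Definition block_bounds lam : seq nat :=
  0 :: rcons (sort leq (undup (col_lengths lam))) n.

Definition is_permutation sigma : bool :=
  uniq sigma && all (fun v => 1 <= v <= n) sigma.

Definition is_lambda_permutation lam sigma : Prop :=
  is_permutation sigma /\
  forall s i j, 1 <= s < size (block_bounds lam) ->
    nth 0 (block_bounds lam) s.-1 < i -> i < j ->
    j <= nth 0 (block_bounds lam) s ->
    nth1 sigma i < nth1 sigma j.

Definition lambda_key lam sigma : tableau :=
  [seq sort leq (take z sigma) | z <- col_lengths lam].

End Shape.

Definition tableau_le (T U : tableau) : Prop :=
  forall j i, is_loc T j i -> entry T j i <= entry U j i.

(* A skew filling of the shape outer / inner; both shapes are given by their   *)
(* column lengths, and only the values of fill on the boxes of the skew shape  *)
(* are meaningful.                                                             *)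
Record skew := Skew {
  outer : seq nat;
  inner : seq nat;
  fill : nat -> nat -> nat
}.

Definition in_skew (S : skew) (j i : nat) : bool :=
  (0 < j) && (nth1 (inner S) j < i <= nth1 (outer S) j).

Definition semistandard_skew (n : nat) (S : skew) : Prop :=
  [/\ [/\ sorted geq (outer S), sorted geq (inner S)
        & forall j, nth1 (inner S) j <= nth1 (outer S) j],
      forall j i, in_skew S j i -> 1 <= fill S j i <= n,
      forall j i, in_skew S j i -> in_skew S j.+1 i ->
        fill S j i <= fill S j.+1 i
    & forall j i, in_skew S j i -> in_skew S j i.+1 ->
        fill S j i < fill S j i.+1].

Definition skew_col_lengths (S : skew) : seq nat :=
  [seq nth1 (outer S) j - nth1 (inner S) j | j <- iota 1 (size (outer S))].

Definition leftmost_column (S : skew) : seq nat :=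
  [seq fill S 1 i | i <- iota (nth1 (inner S) 1).+1
                              (nth1 (outer S) 1 - nth1 (inner S) 1)].

Definition update (f : nat -> nat -> nat) (j i v : nat) : nat -> nat -> nat :=
  fun j' i' => if (j' == j) && (i' == i) then v else f j' i'.

(* hole_moves S f j i f' j' i': in the shape of S filled by f, the empty box   *)
(* (j, i) travels to (j', i'), where it has no neighbour to its right or       *)
(* below, and the resulting filling is f'.  When the two neighbours carry the  *)
(* same value, the lower one moves, which keeps columns strict.                *)
Inductive hole_moves (S : skew) :
    (nat -> nat -> nat) -> nat -> nat ->
    (nat -> nat -> nat) -> nat -> nat -> Prop :=
| HoleStops f j i :
    ~~ in_skew S j.+1 i -> ~~ in_skew S j i.+1 ->
    hole_moves S f j i f j i
| HoleRight f j i f' j' i' :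
    in_skew S j.+1 i -> (in_skew S j i.+1 -> f j.+1 i < f j i.+1) ->
    hole_moves S (update f j i (f j.+1 i)) j.+1 i f' j' i' ->
    hole_moves S f j i f' j' i'
| HoleDown f j i f' j' i' :
    in_skew S j i.+1 -> (in_skew S j.+1 i -> f j i.+1 <= f j.+1 i) ->
    hole_moves S (update f j i (f j i.+1)) j i.+1 f' j' i' ->
    hole_moves S f j i f' j' i'.

Definition inner_corner (S : skew) (j i : nat) : Prop :=
  [/\ 0 < j, 0 < i, i = nth1 (inner S) j & nth1 (inner S) j.+1 < i].

Definition decr_at (s : seq nat) (j : nat) : seq nat :=
  set_nth 0 s j.-1 (nth1 s j).-1.

Definition jdt_slide (S S' : skew) : Prop :=
  exists j i j' i', exists f',
    [/\ inner_corner S j i,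
        hole_moves S (fill S) j i f' j' i'
      & S' = Skew (decr_at (outer S) j') (decr_at (inner S) j) f'].

Inductive rectifies_to (T : tableau) : skew -> Prop :=
| RectDone S :
    all (pred1 0) (inner S) ->
    (forall j i, in_skew S j i = is_loc T j i) ->
    (forall j i, is_loc T j i -> fill S j i = entry T j i) ->
    rectifies_to T S
| RectSlide S S' :
    jdt_slide S S' -> rectifies_to T S' -> rectifies_to T S.

Definition is_left_column (n : nat) (lam : n.-tuple nat) (T : tableau)
    (z : nat) (c : seq nat) : Prop :=
  exists S : skew,
    [/\ semistandard_skew n S, rectifies_to T S,
        perm_eq (skew_col_lengths S) (col_lengths lam),
        leftmost_column S = c
      & size c = z].

(* The column c with is_left_column lam T z c is unique when z is a column     *)
(* length of the shape lam of T; xget selects it.                              *)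
Definition left_key (n : nat) (lam : n.-tuple nat) (T : tableau) : tableau :=
  [seq xget [::] [set c | is_left_column lam T z c]%classic
     | z <- col_lengths lam].

(* Columns are strictly increasing, so a value determines its row. *)
Definition max_below (c : seq nat) (v : nat) : nat :=
  \max_(x <- c | x <= v) x.

Fixpoint scan_from (X : tableau) (v j : nat) : seq (nat * nat) :=
  if j is j'.+1 then
    let w := max_below (column X j) v in
    (j, (index w (column X j)).+1) :: scan_from X w j'
  else [::].

Definition scan_path (X : tableau) (l k : nat) : seq (nat * nat) :=
  (l, k) :: scan_from X (entry X l k) l.-1.

Definition scan_end (X : tableau) (l k : nat) : nat :=
  let p := last (l, k) (scan_path X l k) in entry X p.1 p.2.

Definition remove_beneath (X : tableau) (P : seq (nat * nat)) : tableau :=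
  foldr (fun p Z => set_nth [::] Z p.1.-1 (take p.2.-1 (column Z p.1))) X P.

(* The result of m removals from the first l columns of T, the paths starting  *)
(* in turn from the bottom box of column l.                                    *)
Fixpoint after_removals (T : tableau) (l m : nat) : tableau :=
  if m is m'.+1 then
    let X := after_removals T l m' in
    remove_beneath X (scan_path X l (size (column T l) - m'))
  else take l T.

(* T^(l,k) *)
Definition stage (T : tableau) (l k : nat) : tableau :=
  after_removals T l (size (column T l) - k).

(* V^(l,k) *)
Definition stageV (T : tableau) (l k : nat) : tableau :=
  take l.-1 (stage T l k).

Definition value_interval (a b : nat) : simpl_pred nat := [pred v | a <= v <= b].

Section Conditions.
Variables (n : nat) (lam : n.-tuple nat) (T : tableau) (sigma : n.-tuple nat).
Variables (l k : nat).

Let V := stageV T l k.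
Let Ylk := entry (lambda_key lam sigma) l k.
Let top := (entry_or_top n T l k.+1).-1.

Definition q_index : nat :=
  \max_(i <- iota 1 (size (column V l.-1)) | entry V l.-1 i <= top) i.

Definition g_value (h : nat) : nat := scan_end V l.-1 h.

(* index_iota k q.+1 lists [k, q] increasingly, so that the first and last     *)
(* elements of a filtered list are the minimum and the maximum.                *)
Definition F_set : simpl_pred nat :=
  if l == 1 then value_interval Ylk top
  else if [seq h <- index_iota k q_index.+1 | g_value h >= Ylk] is p :: _
  then value_interval (entry T l.-1 p) top
  else pred0.

Definition G_set : simpl_pred nat :=
  if l == 1 then pred1 Ylk
  else if [seq h <- index_iota k q_index.+1 | g_value h == Ylk] is a :: hs
  then let b := last a hs in
       value_interval (entry T l.-1 a)
         (minn (entry_or_top n V l.-1 b.+1).-1 top)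
  else pred0.

End Conditions.

(* Main.v *)
Require Import Defs.
From mathcomp Require Import all_boot zify.
From mathcomp Require Import boolp classical_sets.

(** The left key is defined by jeu de taquin, the sets F and G by scanning; the
    bridge is that scanning computes the left key, after which the theorem is a
    comparison made box by box.

    Scanning computes the left key (left_key_scan).  A sequence of columns is
    seen as a board of zeros and ones, whose box (j, v) says whether the value v
    occurs in column j.  Two families of crystal operators act on boards: [raise]
    moves an entry from a column to the previous one, and [lower] replaces an
    entry v + 1 by v inside its column.  A jeu de taquin slide is a succession of
    [raise] (jdt_slide_spec), so a skew tableau and its rectification have
    equivalent boards, equivalence being generated by [raise].  The two families
    commute (raise_lower_commute).  Hence [lower] can be applied to a whole
    equivalence class until no [lower] is possible any more; since [lower] is
    injective nothing is lost, and at that stage everything is explicit.  A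
    straight tableau becomes the one whose row i is constant equal to i, so there
    is only one straight tableau in each class (tabular_unique).  A board with the
    same column lengths in another order becomes the board whose columns are
    1, 2, ..., up to their length, because among the columns of a given length
    this one has the least sum; so the order of the lengths determines the board
    (extremal_unique).  Sorting the lengths of all columns but the first, the
    first column depends only on its own length (first_column_unique): this is
    the independence of the choice of a skew tableau.

    It remains to exhibit one such board for each column length.  Let a be a
    column dominating the column b to its right.  A bracketing matches each entry
    of b with an entry of a, and moving the unmatched entries of a to the right
    exchanges the two lengths within the class (conn_swap).  The paths of the left
    scanning, formed from the bottom of column l, perform exactly this matching in
    each column they cross (match_col_spec).  So exchanging lengths repeatedly, the
    entries of column l are carried to the first column, where they become the
    final values of the scanning paths (scan_to_conn).  Any board is the board of
    a skew tableau, each column being placed above the previous one, and by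
    uniqueness of the straight tableau of a class it rectifies to T (conn_rectifies_to).

    The sets F and G.  The path from (l, k) enters column l - 1 in a row h, the
    last one with T(l-1, h) <= T(l, k), and g_h is the entry (l, k) of the left
    key.  As g is weakly increasing in the row, comparing g_h with Y(l, k) amounts
    to comparing h with the bounds p, a, b, that is T(l, k) with entries of column
    l - 1 (scan_row, in_F_set, in_G_set). *)

Set Implicit Arguments.
Unset Strict Implicit.
Unset Printing Implicit Defensive.

(** * Counting the elements of a set of numbers below a bound *)

Definition cnt (c : pred nat) (t : nat) : nat := count c (iota 0 t).

Arguments cnt : simpl never.

Lemma cnt0 c : cnt c 0 = 0.
Proof. by []. Qed.

Lemma cntS c t : cnt c t.+1 = cnt c t + c t.
Proof. by rewrite /cnt -addn1 iotaD count_cat /= add0n addn0. Qed.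

Lemma eq_cnt (c d : pred nat) t : (forall v, v < t -> c v = d v) -> cnt c t = cnt d t.
Proof.
elim: t => [//|t IH] e; rewrite !cntS IH ?e // => v vt; apply: e; exact: leqW.
Qed.

Lemma cnt_mono c s t : s <= t -> cnt c s <= cnt c t.
Proof.
move=> /subnK <-; elim: (t - s) => // k IH.
by rewrite addSn cntS (leq_trans IH) // leq_addr.
Qed.

Lemma cnt_le c s t : s <= t -> cnt c t <= cnt c s + (t - s).
Proof.
move=> /subnK; move: (t - s) => k <-; elim: k => [|k IH]; first by rewrite addn0.
by rewrite addSn cntS; move: IH; case: (c _); lia.
Qed.

Lemma cnt_const c N t : (forall v, N <= v -> c v = false) -> N <= t ->
  cnt c t = cnt c N.
Proof.
move=> c0 /subnK <-; elim: (t - N) => // k IH.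
by rewrite addSn cntS IH c0 ?leq_addl // addn0.
Qed.

Lemma cnt_add (c d : pred nat) x t :
  (forall v, d v = c v || (v == x)) -> c x = false ->
  cnt d t = cnt c t + (x < t).
Proof.
move=> dE cx; elim: t => [//|t IH]; rewrite !cntS IH dE.
by have [->|] := eqVneq t x; rewrite ?cx; case: (c t) => /=; lia.
Qed.

Lemma cnt_shift (c d : pred nat) x y t :
  (forall v, d v = (v == x) || c v && (v != y)) -> c x = false -> c y = true ->
  cnt d t + (y < t) = cnt c t + (x < t).
Proof.
move=> dE cx cy; have xy : x != y by apply/eqP => e; rewrite e cy in cx.
elim: t => [//|t IH]; rewrite !cntS dE.
have [e|] := eqVneq t x; have [e'|] := eqVneq t y; subst; rewrite ?cx ?cy //.
- by rewrite eqxx in xy.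
- lia.
- by rewrite /=; lia.
- by case: (c t) => /=; lia.
Qed.

(** Here [f - g] is the excess of one count over another, which may be negative:
    [f s - g s <= f t - g t] is written as an inequality between sums. *)
Lemma first_argmax (f g : nat -> nat) N :
  exists2 t, t <= N & (forall s, s < t -> f s + g t < f t + g s) /\
                      (forall s, s <= N -> f s + g t <= f t + g s).
Proof.
elim: N => [|N [t tN [t1 t2]]].
  by exists 0 => //; split=> // s; rewrite leqn0 => /eqP->.
have [le|lt] := leqP (f N.+1 + g t) (f t + g N.+1).
  exists t; first exact: leqW.
  by split=> // s; rewrite leq_eqVlt => /predU1P[->//|]; rewrite ltnS => /t2.
exists N.+1 => //; split=> s.
  by rewrite ltnS => /t2; lia.
by rewrite leq_eqVlt => /predU1P[->//|]; rewrite ltnS => /t2; lia.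
Qed.

Lemma last_argmax (f g : nat -> nat) N :
  exists2 t, t <= N & (forall s, t < s <= N -> f s + g t < f t + g s) /\
                      (forall s, s <= N -> f s + g t <= f t + g s).
Proof.
elim: N => [|N [t tN [t1 t2]]].
  by exists 0 => //; split=> // s; first lia; rewrite leqn0 => /eqP->.
have [le|lt] := leqP (f t + g N.+1) (f N.+1 + g t).
  exists N.+1 => //; split=> s; first lia.
  by rewrite leq_eqVlt => /predU1P[->//|]; rewrite ltnS => /t2; lia.
exists t; first exact: leqW.
split=> s; last by rewrite leq_eqVlt => /predU1P[->//|]; rewrite ?ltnS; [lia|move=> /t2].
by move=> /andP[ts]; rewrite leq_eqVlt => /predU1P[->//|]; rewrite ltnS => sN; apply: t1; rewrite ts.
Qed.

(** * Boards and their two families of crystal operators *)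

(** The box of column [j] and value [v] is filled when [v] occurs in the column.
    Columns are numbered from 0.  The boards are infinite, so that the number of
    columns and the largest value need not appear in the operators. *)
Definition board := nat -> nat -> bool.

Definition put (A : board) (j v : nat) (z : bool) : board :=
  fun j' v' => if (j' == j) && (v' == v) then z else A j' v'.

Definition row (A : board) (v : nat) : pred nat := fun j => A j v.

(** Read the values upwards, an entry of column [i] as an opening bracket and an
    entry of column [i.+1] as a closing one.  The last unmatched closing bracket is
    the first place at which the excess of column [i.+1] over column [i] reaches
    its maximum: this is the entry [x] that moves. *)
Definition raise (i x : nat) (A B : board) : Prop :=
  [/\ forall t, t <= x -> cnt (A i.+1) t + cnt (A i) x.+1
                          < cnt (A i.+1) x.+1 + cnt (A i) t,
      forall t, cnt (A i.+1) t + cnt (A i) x.+1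
                <= cnt (A i.+1) x.+1 + cnt (A i) t
    & B = put (put A i x true) i.+1 x false].

(** The same rule between the values [v] and [v.+1], the columns being read from
    right to left.  With partial counts taken from the left instead, the column
    that changes is the last one before which the excess of [v.+1] over [v] is
    minimal. *)
Definition lower (v j : nat) (A B : board) : Prop :=
  [/\ forall t, j < t -> cnt (row A v.+1) j + cnt (row A v) t
                          < cnt (row A v.+1) t + cnt (row A v) j,
      forall t, cnt (row A v.+1) j + cnt (row A v) t
                <= cnt (row A v.+1) t + cnt (row A v) j
    & B = put (put A j v true) j v.+1 false].

Lemma raise_entries i x A B : raise i x A B -> A i x = false /\ A i.+1 x = true.
Proof.
move=> [/(_ x (leqnn x)) + _ _]; rewrite !cntS.
by case: (A i x); case: (A i.+1 x) => //; lia.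
Qed.

Lemma lower_entries v j A B : lower v j A B -> A j v = false /\ A j v.+1 = true.
Proof.
move=> [/(_ j.+1 (leqnn _)) + _ _]; rewrite !cntS /row.
by case: (A j v); case: (A j v.+1) => //; lia.
Qed.

Lemma lower_det v j j' A B B' : lower v j A B -> lower v j' A B' -> B = B'.
Proof.
move=> [a1 a2 ->] [b1 b2 ->].
suff -> : j = j' by [].
have [lt|lt|//] := ltngtP j j'.
- by have := a1 _ lt; have := b2 j; lia.
- by have := b1 _ lt; have := a2 j'; lia.
Qed.

Lemma raise_left i x A B t : raise i x A B ->
  cnt (B i) t = cnt (A i) t + (x < t).
Proof.
move=> r; have [ax bx] := raise_entries r; case: r => _ _ ->.
apply: cnt_add => // v; rewrite /put eqxx /=.
have -> : (i == i.+1) = false by lia.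
by case: (v == x); rewrite ?orbT ?orbF.
Qed.

Lemma raise_right i x A B t : raise i x A B ->
  cnt (B i.+1) t + (x < t) = cnt (A i.+1) t.
Proof.
move=> r; have [ax bx] := raise_entries r; case: r => _ _ ->.
apply/esym/cnt_add; last by rewrite /put !eqxx.
move=> v; rewrite /put eqxx /=.
have -> : (i.+1 == i) = false by lia.
by case: eqVneq => [->|]; rewrite ?bx ?orbF.
Qed.

Lemma raise_other i x A B j : raise i x A B -> j != i -> j != i.+1 -> B j = A j.
Proof.
case=> _ _ -> ji ji'; apply/funext => v.
by rewrite /put (negbTE ji) (negbTE ji').
Qed.

Lemma raise_row_other i x A B v : raise i x A B -> v != x -> row B v = row A v.
Proof.
by case=> _ _ -> vx; apply/funext => j; rewrite /row /put (negbTE vx) !andbF.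
Qed.

Lemma raise_row i x A B t : raise i x A B ->
  cnt (row B x) t + (i.+1 < t) = cnt (row A x) t + (i < t).
Proof.
move=> r; have [ax bx] := raise_entries r; case: r => _ _ ->.
apply: cnt_shift => // v; rewrite /row /put !eqxx !andbT.
have [->|] := eqVneq v i.+1; last by case: (v == i); rewrite ?andbT.
by rewrite andbF orbF; lia.
Qed.

Lemma lower_row v j A B t : lower v j A B ->
  cnt (row B v) t = cnt (row A v) t + (j < t).
Proof.
move=> r; have [ax bx] := lower_entries r; case: r => _ _ ->.
apply: cnt_add => // k; rewrite /row /put eqxx /=.
have -> : (v == v.+1) = false by lia.
by rewrite andbF andbT; case: (k == j); rewrite ?orbT ?orbF.
Qed.

Lemma lower_rowS v j A B t : lower v j A B ->
  cnt (row B v.+1) t + (j < t) = cnt (row A v.+1) t.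
Proof.
move=> r; have [ax bx] := lower_entries r; case: r => _ _ ->.
apply/esym/cnt_add; last by rewrite /row /put !eqxx.
move=> k; rewrite /row /put eqxx /=.
have -> : (v.+1 == v) = false by lia.
by rewrite andbF andbT; case: eqVneq => [->|]; rewrite ?bx ?orbF.
Qed.

Lemma lower_row_other v j A B w : lower v j A B -> w != v -> w != v.+1 ->
  row B w = row A w.
Proof.
case=> _ _ -> ji ji'; apply/funext => k.
by rewrite /row /put (negbTE ji) (negbTE ji') !andbF.
Qed.

Lemma lower_col_other v j A B k : lower v j A B -> k != j -> B k = A k.
Proof.
by case=> _ _ -> kj; apply/funext => w; rewrite /put (negbTE kj).
Qed.

Lemma lower_col v j A B t : lower v j A B ->
  cnt (B j) t + (v.+1 < t) = cnt (A j) t + (v < t).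
Proof.
move=> r; have [ax bx] := lower_entries r; case: r => _ _ ->.
apply: cnt_shift => // w; rewrite /put !eqxx /=.
have [->|] := eqVneq w v.+1; last by case: (w == v); rewrite ?andbT.
by rewrite andbF orbF; lia.
Qed.

(** * The two families commute *)

(** The operators interact only through the block of the columns [i], [i.+1] and
    the values [v], [v.+1].  Outside of two configurations of this block, each move
    changes the partial counts governing the other one at most in the middle of
    the block, at a place that is not extremal.  In the remaining two, the
    moves would both fill, or both empty, the same box; the one performed second
    then takes place in the other column, or on the other value, of the block. *)
Lemma raise_lower_commute i x v j A B C :
  raise i x A B -> lower v j A C ->
  exists j' x' D, lower v j' B D /\ raise i x' C D.
Proof.
move=> r l.
have [ax bx] := raise_entries r; have [cj dj] := lower_entries l.
have [r1 r2 rB] := r; have [l1 l2 lC] := l.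
pose c1 := cntS (A i); pose c2 := cntS (A i.+1).
have d1 k : cnt (row A v) k.+1 = cnt (row A v) k + A k v by rewrite cntS.
have d2 k : cnt (row A v.+1) k.+1 = cnt (row A v.+1) k + A k v.+1 by rewrite cntS.
have [/andP[/orP[] /eqP ex /orP[] /eqP ej]|far] :=
  boolP (((x == v) || (x == v.+1)) && ((j == i) || (j == i.+1))); try subst x j.
- (* The box (i, v) of the block is empty and the three others are filled. *)
  have dd : A i.+1 v.+1.
    have := l1 i.+2 (leqnSn _); rewrite !cntS /row ax bx dj.
    by case: (A i.+1 v.+1) => //; lia.
  exists i.+1, v.+1, (put (put B i.+1 v true) i.+1 v.+1 false); split.
    split=> // t; rewrite !(raise_row_other r (v := v.+1)) //; try lia.
      have := raise_row t r; have := raise_row i.+1 r.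
      have := d1 i; have := d2 i; rewrite ax dj => e1 e2 e3 e4 it.
      by have := l1 t; lia.
    have := raise_row t r; have := raise_row i.+1 r.
    have := d1 i; have := d2 i; rewrite ax dj => e1 e2 e3 e4.
    have := l2 t; have := l1 t.
    by have [?|] := ltnP i t; lia.
  split=> [t tv|t|].
  - rewrite !(lower_col_other l (k := i.+1)); try lia.
    have := lower_col t l; have := lower_col v.+2 l.
    have := c1 v.+1; have := c2 v.+1; rewrite dj dd => e1 e2 e3 e4.
    have := r1 t; have := r2 t; lia.
  - rewrite !(lower_col_other l (k := i.+1)); try lia.
    have := lower_col t l; have := lower_col v.+2 l.
    have := c1 v.+1; have := c2 v.+1; rewrite dj dd => e1 e2 e3 e4.
    have := r2 t; lia.
  - apply/funext => k; apply/funext => w; rewrite rB lC /put.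
    have F1 : (i.+1 == i) = false by lia.
    have F2 : (i == i.+1) = false by lia.
    have F3 : (v.+1 == v) = false by lia.
    have F4 : (v == v.+1) = false by lia.
    case: (eqVneq k i.+1) => [->|nk] /=; rewrite ?F1 ?F2 /=.
      case: (eqVneq w v) => [->|nw] /=; first by rewrite F4 /= bx.
      by [].
    case: (eqVneq k i) => [->|] /=; rewrite ?F1 ?F2 //=.
    case: (eqVneq w v) => [->|nw] /=; first by rewrite F4 /=.
    by case: eqVneq => [->|]; rewrite ?dj.
- by rewrite bx in cj.
- by rewrite dj in ax.
- (* The box (i+1, v+1) of the block is filled and the three others are empty. *)
  have aa : A i v = false.
    have := r1 v (leqnSn _); rewrite !cntS ax bx cj; case: (A i v) => //; lia.
  exists i, v, (put (put B i v true) i v.+1 false); split.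
    split=> // t; rewrite !(raise_row_other r (v := v)) //; try lia.
      have := raise_row t r; have := raise_row i r.
      have := d1 i; have := d2 i; rewrite ax aa => e1 e2 e3 e4 it.
      by have := l1 t; have := l2 t; lia.
    have := raise_row t r; have := raise_row i r.
    have := d1 i; have := d2 i; rewrite ax aa => e1 e2 e3 e4.
    by have := l2 t; lia.
  split=> [t tv|t|].
  - rewrite !(lower_col_other l (k := i)); try lia.
    have := lower_col t l; have := lower_col v.+1 l.
    have := c1 v.+1; have := c2 v.+1; rewrite dj ax => e1 e2 e3 e4.
    have := r1 t; have := r2 t; lia.
  - rewrite !(lower_col_other l (k := i)); try lia.
    have := lower_col t l; have := lower_col v.+1 l.
    have := c1 v.+1; have := c2 v.+1; rewrite dj ax => e1 e2 e3 e4.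
    have := r1 t; have := r2 t; lia.
  - apply/funext => k; apply/funext => w; rewrite rB lC /put.
    have F1 : (i.+1 == i) = false by lia.
    have F2 : (i == i.+1) = false by lia.
    have F3 : (v.+1 == v) = false by lia.
    have F4 : (v == v.+1) = false by lia.
    case: (eqVneq k i.+1) => [->|nk] /=; rewrite ?F1 ?F2 /=.
      case: (eqVneq w v) => [->|nw] /=; first by rewrite F4 /= cj.
      by [].
    case: (eqVneq k i) => [->|] /=; rewrite ?F1 ?F2 //=.
    case: (eqVneq w v) => [->|nw] /=; first by rewrite F4 /=.
    by case: eqVneq => [->|]; rewrite ?ax.
(* At most one of the two moves takes place inside the block: both are kept. *)
have E : put (put B j v true) j v.+1 false = put (put C i x true) i.+1 x false.
  apply/funext => k; apply/funext => w; rewrite rB lC /put.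
  case K1: ((k == i) && (w == x)); case K2: ((k == i.+1) && (w == x));
  case K3: ((k == j) && (w == v)); case K4: ((k == j) && (w == v.+1)) => //;
  by exfalso; move: far K1 K2 K3 K4; lia.
exists j, x, (put (put B j v true) j v.+1 false); split; split=> //.
- move=> t jt; have := l1 t jt; have := l1 i.+2; have := l1 i; have := l2 t; have := l2 i.+2.
  have := r2 v.+2; have := r1 v.
  have := d1 i; have := d1 i.+1; have := d2 i; have := d2 i.+1.
  have := c1 v; have := c1 v.+1; have := c2 v; have := c2 v.+1.
  have [ex|nx] := eqVneq x v; last have [ex|nx'] := eqVneq x v.+1; subst.
  + rewrite !(raise_row_other r (v := v.+1)); try lia.
    have := raise_row t r; have := raise_row j r.
    move: far; rewrite eqxx /= ax bx => nj.
    have [et|nt] := eqVneq t i.+1; [subst t|]; lia.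
  + rewrite !(raise_row_other r (v := v)); try lia.
    have := raise_row t r; have := raise_row j r.
    move: far; rewrite eqxx orbT /= ax bx => nj.
    lia.
  + have nv : v != x by lia.
    have nv' : v.+1 != x by lia.
    rewrite (raise_row_other r nv) (raise_row_other r nv'); lia.
- move=> t; have := l2 t; have := l2 i.+2; have := l2 i; have := l1 i; have := l1 i.+2.
  have := r2 v.+2; have := r1 v.
  have := d1 i; have := d1 i.+1; have := d2 i; have := d2 i.+1.
  have := c1 v; have := c1 v.+1; have := c2 v; have := c2 v.+1.
  have [ex|nx] := eqVneq x v; last have [ex|nx'] := eqVneq x v.+1; subst.
  + rewrite !(raise_row_other r (v := v.+1)); try lia.
    have := raise_row t r; have := raise_row j r.
    move: far; rewrite eqxx /= ax bx => nj.
    have [et|nt] := eqVneq t i.+1; [subst t|]; lia.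
  + rewrite !(raise_row_other r (v := v)); try lia.
    have := raise_row t r; have := raise_row j r.
    move: far; rewrite eqxx orbT /= ax bx => nj.
    lia.
  + have nv : v != x by lia.
    have nv' : v.+1 != x by lia.
    rewrite (raise_row_other r nv) (raise_row_other r nv'); lia.
- move=> t tx; have := r1 t tx; have := r1 v; have := r2 v.+2; have := r1 v.+2; have := r2 v; have := l2 i.
  have := d1 i; have := d1 i.+1; have := d2 i; have := d2 i.+1.
  have := c1 v; have := c1 v.+1; have := c2 v; have := c2 v.+1.
  have [ej|nj] := eqVneq j i; last have [ej|nj'] := eqVneq j i.+1; subst.
  + rewrite !(lower_col_other l (k := i.+1)); try lia.
    have := lower_col t l; have := lower_col x.+1 l.
    move: far; rewrite eqxx /= andbT => nj. lia.
  + rewrite !(lower_col_other l (k := i)); try lia.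
    have := lower_col t l; have := lower_col x.+1 l.
    move: far; rewrite eqxx /= ?orbT andbT => nj'. rewrite cj dj.
    have [et|nt] := eqVneq t v.+1; [subst t|]; lia.
  + have ni : i != j by lia.
    have ni' : i.+1 != j by lia.
    rewrite (lower_col_other l ni) (lower_col_other l ni'); lia.
- move=> t; have := r2 t; have := r1 v; have := r2 v.+2; have := r1 v.+2; have := r2 v; have := l2 i.
  have := d1 i; have := d1 i.+1; have := d2 i; have := d2 i.+1.
  have := c1 v; have := c1 v.+1; have := c2 v; have := c2 v.+1.
  have [ej|nj] := eqVneq j i; last have [ej|nj'] := eqVneq j i.+1; subst.
  + rewrite !(lower_col_other l (k := i.+1)); try lia.
    have := lower_col t l; have := lower_col x.+1 l.
    move: far; rewrite eqxx /= andbT => nj. lia.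
  + rewrite !(lower_col_other l (k := i)); try lia.
    have := lower_col t l; have := lower_col x.+1 l.
    move: far; rewrite eqxx /= ?orbT andbT => nj'. rewrite cj dj.
    have [et|nt] := eqVneq t v.+1; [subst t|]; lia.
  + have ni : i != j by lia.
    have ni' : i.+1 != j by lia.
    rewrite (lower_col_other l ni) (lower_col_other l ni'); lia.
Qed.

(** * Reduction of a class by the row operators *)

Definition supported (m n : nat) (A : board) : Prop :=
  forall j v, A j v -> (j < m) && (0 < v <= n).

(** The equivalence generated by [raise] on the first [m] columns: the classes are
    the connected components of the crystal of the column operators. *)
Inductive conn (m : nat) : board -> board -> Prop :=
| conn_refl A : conn m A A
| conn_raise A B C i x : i.+1 < m -> raise i x A B -> conn m B C -> conn m A C
| conn_drop A B C i x : i.+1 < m -> raise i x B A -> conn m B C -> conn m A C.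

Lemma conn_trans m A B C : conn m A B -> conn m B C -> conn m A C.
Proof.
elim=> // {A B} [A B D i x im r _ IH /IH|A B D i x im r _ IH /IH];
  [exact: conn_raise im r | exact: conn_drop im r].
Qed.

Lemma conn_sym m A B : conn m A B -> conn m B A.
Proof.
elim=> [{A B} A|{A B} A B D i x im r _ IH|{A B} A B D i x im r _ IH].
- exact: conn_refl.
- by apply: conn_trans IH (conn_drop im r _); apply: conn_refl.
- by apply: conn_trans IH (conn_raise im r _); apply: conn_refl.
Qed.

Lemma raise_entry i x A B j v : raise i x A B ->
  B j v = if (j == i.+1) && (v == x) then false
          else if (j == i) && (v == x) then true else A j v.
Proof. by case=> _ _ ->. Qed.

Lemma raise_supported m n i x A B : i.+1 < m -> raise i x A B ->
  supported m n A <-> supported m n B.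
Proof.
move=> im r; have [ax bx] := raise_entries r; have E := raise_entry _ _ r.
split=> s j v.
  rewrite E; case: ifP => // _; case: ifP => [/andP[/eqP-> /eqP->] _|_ /s //].
  by have := s _ _ bx; lia.
have [/andP[/eqP-> /eqP->] _|f1] := boolP ((j == i.+1) && (v == x)).
  have /s : B i x by rewrite E !eqxx; case: ifP => //; lia.
  lia.
have [/andP[/eqP-> /eqP->]|f2 jv] := boolP ((j == i) && (v == x)); first by rewrite ax.
by apply: s; rewrite E (negbTE f1) (negbTE f2).
Qed.

Lemma conn_supported m n A B : conn m A B -> supported m n A -> supported m n B.
Proof.
by elim=> // {A B} A B C i x im r _ IH s; apply: IH; apply/(raise_supported n im r).
Qed.

Lemma lower_supported m n v j A B : 0 < v -> lower v j A B -> supported m n A ->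
  supported m n B.
Proof.
move=> v0 l s k w; have [_ /s jv] := lower_entries l; case: l => _ _ ->.
rewrite /put; case: ifP => // _; case: ifP => [/andP[/eqP-> /eqP->]|_ /s //]; lia.
Qed.

Lemma row_const m n A v t : supported m n A -> m <= t ->
  cnt (row A v) t = cnt (row A v) m.
Proof.
move=> s mt; apply: cnt_const => // k mk.
by rewrite /row; apply/negP => /s; lia.
Qed.

Lemma lower_exists m n v A t : supported m n A ->
  cnt (row A v.+1) t + cnt (row A v) m < cnt (row A v.+1) m + cnt (row A v) t ->
  exists j B, lower v j A B.
Proof.
move=> s lt.
have [j jm [j1 j2]] := last_argmax (cnt (row A v)) (cnt (row A v.+1)) m.
have tm : t < m.
  by rewrite ltnNge; apply/negP => mt; move: lt; rewrite !(row_const _ s mt) ltnn.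
have jm' : j < m.
  rewrite ltn_neqAle jm andbT; apply/negP => /eqP ej; subst j.
  by have := j2 t; lia.
have jj : cnt (row A v.+1) j + cnt (row A v) m < cnt (row A v.+1) m + cnt (row A v) j.
  by have := j1 m; lia.
exists j; eexists; split; last reflexivity.
  move=> u ju; have [um|/ltnW um] := leqP u m; first by have := j1 u; lia.
  by rewrite !(row_const _ s um).
move=> u; have [um|/ltnW um] := leqP u m; first by have := j2 u um; lia.
rewrite !(row_const _ s um); lia.
Qed.

Lemma lower_col_lt m n v j A B : supported m n A -> lower v j A B -> j < m.
Proof. by move=> s /lower_entries[_ /s]; lia. Qed.

(** It suffices that [A] admits some [lower], since the previous commutation and
    the determinism of [lower] then identify the square.  The count that was
    minimal for [B] is still low enough for [A], except possibly when it lies between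
    the columns [i] and [i.+1]; then the count before column [i] is as low. *)
Lemma lower_raise_back m n i x v j A B C :
  supported m n A -> i.+1 < m -> raise i x A B -> lower v j B C ->
  exists j' x' D, lower v j' A D /\ raise i x' D C.
Proof.
move=> s im r l.
have sB : supported m n B by apply/(raise_supported n im r).
have jm := lower_col_lt sB l.
have [l1 l2 _] := l.
have [t lt] : exists t, cnt (row A v.+1) t + cnt (row A v) m
                        < cnt (row A v.+1) m + cnt (row A v) t.
  have [ax bx] := raise_entries r.
  have [ev|nv] := eqVneq v x; last have [ev|nv'] := eqVneq v.+1 x; subst.
  - have nx : x.+1 != x by lia.
    have Rt t := raise_row t r; have Rt' := raise_row_other r nx.
    rewrite Rt' in l1 l2.
    have [ej|nj] := eqVneq j i.+1; last first.
      by exists j; have := l1 m jm; have := Rt j; have := Rt m; lia.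
    exists i; subst j; have := l1 m jm; have := Rt i.+1; have := Rt m.
    have := l2 i; have := Rt i.
    have [_ r2 _] := r; have := r2 x.+2; rewrite !cntS ax bx /row ax.
    have [_] := lower_entries l; rewrite (_ : B i.+1 x.+1 = row B x.+1 i.+1) // Rt' /row => ->.
    by case: (A i x.+1) => /=; lia.
  - have Rt t := raise_row t r; have Rt' := raise_row_other r nv.
    rewrite Rt' in l1 l2.
    by exists j; have := l1 m jm; have := Rt j; have := Rt m; lia.
  - rewrite (raise_row_other r nv) (raise_row_other r nv') in l1 l2.
    by exists j; apply: l1.
have [j' [D lD]] := lower_exists s lt.
have [j'' [x' [E [lE rE]]]] := raise_lower_commute r lD.
by exists j', x', D; split=> //; rewrite (lower_det l lE).
Qed.

Lemma conn_lower m n v j A B A' : supported m n A -> conn m A B -> lower v j A A' ->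
  exists j' B', lower v j' B B' /\ conn m A' B'.
Proof.
move=> + c; elim: c j A' => {A B} [A|A B C i x im r _ IH|A B C i x im r _ IH] j A' s l.
- by exists j, A'; split=> //; apply: conn_refl.
- have [j' [x' [D [lD rD]]]] := raise_lower_commute r l.
  have sB : supported m n B by apply/(raise_supported n im r).
  have [j'' [C' [lC cC]]] := IH _ _ sB lD.
  by exists j'', C'; split=> //; apply: conn_raise im rD cC.
- have sB : supported m n B by apply/(raise_supported n im r).
  have [j' [x' [D [lD rD]]]] := lower_raise_back sB im r l.
  have [j'' [C' [lC cC]]] := IH _ _ sB lD.
  by exists j'', C'; split=> //; apply: conn_drop im rD cC.
Qed.

(** The column changed by [lower] can be read off the result: the excess of [v.+1]
    over [v] is minimal for the first time just after it. *)
Lemma lower_inj v j j' A B C : lower v j A C -> lower v j' B C -> A = B.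
Proof.
have argmin k D : lower v k D C ->
    (forall t, t <= k -> cnt (row C v.+1) k.+1 + cnt (row C v) t
                         < cnt (row C v.+1) t + cnt (row C v) k.+1) /\
    (forall t, cnt (row C v.+1) k.+1 + cnt (row C v) t
               <= cnt (row C v.+1) t + cnt (row C v) k.+1).
  move=> l; have [dv dv'] := lower_entries l; have [l1 l2 _] := l.
  have := lower_row k.+1 l; have := lower_rowS k.+1 l.
  rewrite (cntS (row D v.+1)) (cntS (row D v)) /row dv dv' => e1 e2.
  split=> t; [move=> tk|]; have := lower_row t l; have := lower_rowS t l; rewrite /row in e1 e2 *;
    have := l2 t; have := l1 t; rewrite /row; lia.
move=> lA lB; have [a1 a2] := argmin _ _ lA; have [b1 b2] := argmin _ _ lB.
have ej : j = j'.
  have [lt|lt|//] := ltngtP j j'.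
    by have := b1 _ lt; have := a2 j'.+1; lia.
  by have := a1 _ lt; have := b2 j.+1; lia.
subst j'; have [av av'] := lower_entries lA; have [bv bv'] := lower_entries lB.
case: lA => _ _ eA; case: lB => _ _ eB.
apply/funext => k; apply/funext => w.
have := congr1 (fun D : board => D k w) eA; rewrite eB /put.
have [/andP[/eqP-> /eqP->]|_] := boolP ((k == j) && (w == v.+1)); first by rewrite av' bv'.
by have [/andP[/eqP-> /eqP->]|_ ->] := boolP ((k == j) && (w == v)); first by rewrite av bv.
Qed.

(** Only the values are recorded: along an equivalence, the columns in which the
    operators act may vary. *)
Inductive lowers : seq nat -> board -> board -> Prop :=
| lowers_nil A : lowers [::] A A
| lowers_cons v j vs A B C : 0 < v -> lower v j A B -> lowers vs B C ->
    lowers (v :: vs) A C.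

Lemma lowersP v vs A C : lowers (v :: vs) A C ->
  exists j B, [/\ 0 < v, lower v j A B & lowers vs B C].
Proof. by move=> l; inversion l; subst; exists j, B. Qed.

Lemma lowers_nilP A C : lowers [::] A C -> A = C.
Proof. by move=> l; inversion l. Qed.

Lemma lowers_inj vs A B C : lowers vs A C -> lowers vs B C -> A = B.
Proof.
elim: vs A B => [|v vs IH] A B; first by move=> /lowers_nilP-> /lowers_nilP->.
move=> /lowersP[j [A1 [_ lA lA1]]] /lowersP[j' [B1 [_ lB lB1]]].
have e := IH _ _ lA1 lB1; subst A1; exact: lower_inj lA lB.
Qed.

Lemma conn_lowers m n vs A B A' : supported m n A -> conn m A B -> lowers vs A A' ->
  exists B', lowers vs B B' /\ conn m A' B'.
Proof.
elim: vs A B => [|v vs IH] A B s c.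
  by move=> /lowers_nilP <-; exists B; split=> //; apply: lowers_nil.
move=> /lowersP[j [A1 [v0 lA lA1]]].
have [j' [B1 [lB c1]]] := conn_lower s c lA.
have [B' [lB' c']] := IH _ _ (lower_supported v0 lA s) c1 lA1.
by exists B'; split=> //; apply: lowers_cons v0 lB lB'.
Qed.

(** Highest weight for the row operators. *)
Definition top (A : board) : Prop := forall v j B, 0 < v -> ~ lower v j A B.

Lemma conn_top m n A B : supported m n A -> conn m A B -> top A -> top B.
Proof.
move=> s c tA v j C v0 l.
have [j' [D [lD _]]] := conn_lower (conn_supported c s) (conn_sym c) l.
exact: tA lD.
Qed.

(** Columns form a straight tableau when, below each bound, every column has at
    least as many entries as the next one.  On a board with finitely many entries
    this means that no [raise] is possible. *)
Definition tabular (A : board) : Prop := forall i t, cnt (A i.+1) t <= cnt (A i) t.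

Lemma lower_tabular v j A B : lower v j A B -> tabular A -> tabular B.
Proof.
move=> l tA i t; have [av dv] := lower_entries l; have [l1 l2 _] := l.
have := tA i t; have [ej|nj] := eqVneq j i; last have [ej|nj'] := eqVneq j i.+1; subst.
- have n1 : i.+1 != i by lia.
  rewrite (lower_col_other l n1); have := lower_col t l; lia.
- have n1 : i != i.+1 by lia.
  rewrite (lower_col_other l n1); have := lower_col t l.
  have := l2 i; rewrite !cntS /row.
  have := tA i v; have := tA i v.+2; rewrite !cntS av dv.
  by have [->|nt] := eqVneq t v.+1; rewrite ?cntS ?av; lia.
- have n1 : i != j by lia.
  have n2 : i.+1 != j by lia.
  by rewrite (lower_col_other l n1) (lower_col_other l n2).
Qed.

Lemma lower_size m n v j A B k : supported m n A -> lower v j A B ->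
  cnt (B k) n.+1 = cnt (A k) n.+1.
Proof.
move=> s l; have [ej|nj] := eqVneq k j; last by rewrite (lower_col_other l nj).
subst k; have [_ /s jv] := lower_entries l; have := lower_col n.+1 l; lia.
Qed.

Lemma lowers_keep m n vs A B : supported m n A -> lowers vs A B ->
  [/\ supported m n B, tabular A -> tabular B
    & forall k, cnt (B k) n.+1 = cnt (A k) n.+1].
Proof.
elim: vs A => [|v vs IH] A s; first by move=> /lowers_nilP <-.
move=> /lowersP[j [A1 [v0 lA lA1]]].
have [s1 t1 e1] := IH _ (lower_supported v0 lA s) lA1; split=> // [tA|k].
  exact/t1/lower_tabular/tA/lA.
by rewrite e1 (lower_size _ s lA).
Qed.

(** * Boards that are determined by their class *)

Lemma cnt_sum c t : cnt c t = \sum_(v < t) c v.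
Proof. by elim: t => [|t IH]; rewrite ?big_ord0 // big_ord_recr cntS IH. Qed.

Definition weight (n : nat) (c : pred nat) : nat := \sum_(v < n.+1) v * c v.

(** The sum of all entries: invariant under [raise], decreased by [lower]. *)
Definition energy (m n : nat) (A : board) : nat := \sum_(j < m) weight n (A j).

Lemma energy_rows m n A : energy m n A = \sum_(v < n.+1) v * cnt (row A v) m.
Proof.
rewrite /energy /weight exchange_big; apply: eq_bigr => v _.
by rewrite cnt_sum big_distrr.
Qed.

Lemma conn_row m A B v : conn m A B -> cnt (row A v) m = cnt (row B v) m.
Proof.
elim=> // {A B} A B C i x im r _ <-.
  have [->|vx] := eqVneq v x; last by rewrite (raise_row_other r vx).
  by have := raise_row m r; lia.
have [->|vx] := eqVneq v x; last by rewrite (raise_row_other r vx).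
by have := raise_row m r; lia.
Qed.

Lemma conn_energy m n A B : conn m A B -> energy m n A = energy m n B.
Proof.
by move=> c; rewrite !energy_rows; apply: eq_bigr => v _; rewrite (conn_row _ c).
Qed.

Lemma lower_energy m n v j A B : supported m n A -> lower v j A B ->
  (energy m n B).+1 = energy m n A.
Proof.
move=> s l; have jm := lower_col_lt s l; have [_ /s vn] := lower_entries l.
have one k : k < n.+1 -> \sum_(w < n.+1) (w == k :> nat) * k = k.
  move=> kn; rewrite (bigD1 (Ordinal kn)) //= eqxx mul1n big1 ?addn0 // => w.
  by rewrite -val_eqE /= => /negbTE->.
suff : energy m n B + v.+1 = energy m n A + v by lia.
have vn1 : v < n.+1 by lia.
have vn2 : v.+1 < n.+1 by lia.
rewrite !energy_rows -{2}(one _ vn1) -[in LHS](one _ vn2) -!big_split /=.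
apply: eq_bigr => w _; have [e|nw] := eqVneq (w : nat) v; last have [e|nw'] := eqVneq (w : nat) v.+1; rewrite ?e.
- by have := lower_row m l; nia.
- by have := lower_rowS m l; nia.
- by rewrite (lower_row_other l nw nw').
Qed.

Lemma lowers_exists_top m n A : supported m n A ->
  exists vs B, lowers vs A B /\ top B.
Proof.
move: {2}(energy m n A) (erefl (energy m n A)) => N; elim: N A => [|N IH] A eN s.
  exists [::], A; split; first exact: lowers_nil.
  by move=> v j B v0 l; have := lower_energy s l; rewrite eN.
have [tA|] := pselect (top A).
  by exists [::], A; split=> //; apply: lowers_nil.
move=> nt; have [v [j [B [v0 l]]]] : exists v j B, 0 < v /\ lower v j A B.
  apply: contrapT => h; apply: nt => v j B v0 l; apply: h; by exists v, j, B.
have [|vs [C [lC tC]]] := IH B _ (lower_supported v0 l s).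
  by have := lower_energy s l; lia.
by exists (v :: vs), C; split=> //; apply: lowers_cons v0 l lC.
Qed.

Lemma down_closed (c : pred nat) N : (forall t, c t -> t < N) ->
  (forall t, c t.+1 -> c t) -> forall t, c t = (t < cnt c N).
Proof.
move=> cN cd.
have dn s t : s <= t -> c t -> c s.
  by move=> /subnK <-; elim: (t - s) => // k IH; rewrite addSn => /cd.
have cnt1 t : c t -> cnt c t.+1 = t.+1.
  elim: t => [|t IH] ct; first by rewrite cntS ct.
  by rewrite cntS ct IH ?addn1 //; apply: cd.
move=> t; apply/idP/idP => [ct|].
  by have := cnt1 t ct; have := cnt_mono c (cN _ ct); lia.
apply: contraLR => nct; rewrite -leqNgt.
have -> : cnt c N = cnt c (minn N t).
  have [le|lt] := leqP N t; first by [].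
  apply: cnt_const (ltnW lt) => v tv; apply: contraNF nct; exact: dn.
by have := cnt_le c (leq0n (minn N t)); rewrite cnt0; lia.
Qed.

Lemma down_closed_column (c : pred nat) n : (forall v, c v -> 0 < v <= n) ->
  (forall v, 0 < v -> c v.+1 -> c v) -> forall v, c v = (0 < v <= cnt c n.+1).
Proof.
move=> cn cd.
have c0 : c 0 = false by apply/negP => /cn.
have sh t : cnt c t.+1 = cnt (fun v => c v.+1) t.
  by elim: t => [|t IH]; rewrite cntS ?c0 // IH cntS.
case=> [|v]; first by rewrite c0.
rewrite sh /= -(@down_closed (fun v => c v.+1)) // => t; first by move=> /cn; lia.
exact: cd.
Qed.

Lemma tabular_mono A i j t : tabular A -> i <= j -> cnt (A j) t <= cnt (A i) t.
Proof.
move=> tA /subnK <-; elim: (j - i) => // k IH.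
by rewrite addSn; apply: leq_trans IH; apply: tA.
Qed.

(** Induction from the right.  If [v.+1] occurs in column [j] without [v], a later
    column must contain [v] without [v.+1], otherwise a [lower] is possible.  That
    column contains all of 1, ..., [v], hence column [j], which dominates it,
    has at least [v] entries up to [v]: a contradiction. *)
Lemma top_tabular_down m n A : supported m n A -> top A -> tabular A ->
  forall j v, 0 < v -> A j v.+1 -> A j v.
Proof.
move=> s tp tA j; move: {2}(m - j) (leqnn (m - j)) => k; elim: k j => [|k IH] j mj v v0 jv.
  by have := s _ _ jv; lia.
apply: contrapT => nv.
have suffix t : cnt (row A v.+1) m + cnt (row A v) t <= cnt (row A v.+1) t + cnt (row A v) m.
  rewrite leqNgt; apply/negP => lt.
  by have [u [B lB]] := lower_exists s lt; exact: tp lB.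
have [t [jt tv tv']] : exists t, [/\ j < t, A t v & A t v.+1 = false].
  have jm : j.+1 <= m by have := s _ _ jv; lia.
  have : cnt (row A v.+1) m + cnt (row A v) j.+1 < cnt (row A v.+1) j.+1 + cnt (row A v) m.
    by have := suffix j; rewrite !cntS /row jv (negbTE (introN idP nv)); lia.
  rewrite -(subnK jm); elim: (m - j.+1) => [|d IHd]; first by rewrite ltnn.
  rewrite addSn !(cntS _ (d + _)) => lt.
  have [le|/IHd//] := leqP (cnt (row A v.+1) j.+1 + cnt (row A v) (d + j.+1))
    (cnt (row A v.+1) (d + j.+1) + cnt (row A v) j.+1).
  exists (d + j.+1).
  move: le lt; rewrite /row; case: (A _ v); case: (A _ v.+1) => le lt; try by exfalso; lia.
  by split=> //; lia.
have mt : m - t <= k by have := s _ _ tv; lia.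
have full w : 0 < w <= v -> A t w.
  move=> /andP[w0 wv]; have : A t v by []; rewrite -(subnK wv).
  elim: (v - w) => // d IHd /=; rewrite addSn => /IH; rewrite ltn_addl // => /(_ mt isT).
  exact: IHd.
have cv u : u <= v -> cnt (A t) u.+1 = u.
  elim: u => [|u IHu] uv; rewrite cntS.
    by rewrite cnt0 (_ : A t 0 = false) //; apply/negP => /s; lia.
  by rewrite IHu ?full //; lia.
have A0 : A j 0 = false by apply/negP => /s; lia.
have := tabular_mono v.+1 tA (ltnW jt); rewrite cv // cntS (negbTE (introN idP nv)).
by have := cnt_le (A j) v0; rewrite (cntS _ 0) A0 cnt0; lia.
Qed.

Lemma top_tabular_columns m n A : supported m n A -> top A -> tabular A ->
  forall j v, A j v = (0 < v <= cnt (A j) n.+1).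
Proof.
move=> s tp tA j v; apply: down_closed_column => w; first by move=> /s; lia.
exact: top_tabular_down s tp tA j w.
Qed.

Lemma top_tabular_rows m n A : supported m n A -> top A -> tabular A ->
  forall j v, A j v = (j < cnt (row A v) m).
Proof.
move=> s tp tA j v; have col := top_tabular_columns s tp tA.
apply: (@down_closed (row A v)) => t; first by move=> /s; lia.
rewrite /row !col; have := tA t n.+1; lia.
Qed.

(** After reduction each row of a straight tableau is constant, so the shape can be
    read off the numbers of occurrences of the values, which [raise] preserves. *)
Lemma tabular_unique m n A B : supported m n A -> conn m A B ->
  tabular A -> tabular B -> A = B.
Proof.
move=> s c tA tB; have [vs [A' [lA tpA]]] := lowers_exists_top s.
have [B' [lB c']] := conn_lowers s c lA.
have [sA' tA' _] := lowers_keep s lA.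
have [sB' tB' _] := lowers_keep (conn_supported c s) lB.
suff e : A' = B' by subst B'; exact: lowers_inj lA lB.
apply/funext => j; apply/funext => v.
rewrite (top_tabular_rows sA' tpA (tA' tA)).
by rewrite (top_tabular_rows sB' (conn_top sA' c' tpA) (tB' tB)) (conn_row _ c').
Qed.

(** Exchanging an entry larger than the size [s] for a missing value which is at
    most [s] decreases the sum.  The sums are doubled so that comparing the values
    with the half-integer [s + 1/2] makes each difference count at least once. *)
Lemma weight_min n (c : pred nat) : (forall v, c v -> 0 < v <= n) ->
  2 * weight n (fun v => 0 < v <= cnt c n.+1)
    + \sum_(v < n.+1) (c v != (0 < v <= cnt c n.+1)) <= 2 * weight n c.
Proof.
move=> cn; set s := cnt c n.+1.
have sn : s <= n.
  have := cnt_le c (ltn0Sn n); rewrite (cntS _ 0) (_ : c 0 = false) //; first by rewrite cnt0 -/s; lia.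
  by apply/negP => /cn.
have ds : \sum_(v < n.+1) (0 < v <= s) = s.
  have dk k : k <= s -> cnt (fun v => 0 < v <= s) k.+1 = k.
    by elim: k => [|k IH] ks; rewrite cntS ?IH //; lia.
  rewrite -(cnt_sum (fun v => 0 < v <= s)) (_ : n.+1 = (n - s) + s.+1); last by lia.
  by elim: (n - s) => [|k IH]; [exact: dk | rewrite addSn cntS IH; lia].
have cs : \sum_(v < n.+1) c v = s by rewrite -cnt_sum.
have : \sum_(v < n.+1) (2 * (v * (0 < v <= s)) + (c v != (0 < v <= s)) + (2 * s).+1 * c v)
    <= \sum_(v < n.+1) (2 * (v * c v) + (2 * s).+1 * (0 < v <= s)).
  apply: leq_sum => v _; case cv: (c v); case: (boolP (0 < v <= s)) => /= h;
    rewrite ?muln1 ?muln0; try (have := cn _ cv); lia.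
have split2 (f g : 'I_n.+1 -> nat) : \sum_v (f v + g v) = \sum_v f v + \sum_v g v.
  exact: big_split.
have split3 (f g h : 'I_n.+1 -> nat) :
    \sum_v (f v + g v + h v) = \sum_v f v + \sum_v g v + \sum_v h v.
  by rewrite split2 split2.
rewrite (split3 (fun v => 2 * (v * (0 < v <= s))) (fun v => c v != (0 < v <= s) : nat)
  (fun v => (2 * s).+1 * c v)).
rewrite (split2 (fun v => 2 * (v * c v)) (fun v => (2 * s).+1 * (0 < v <= s))).
by rewrite -(big_distrr (2 * s).+1) -(big_distrr (2 * s).+1) ds cs leq_add2r -!(big_distrr 2).
Qed.

Definition sizes (m n : nat) (A : board) : seq nat := mkseq (fun j => cnt (A j) n.+1) m.

Lemma sum_sizes m n A (g : nat -> nat) :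
  \sum_(z <- sizes m n A) g z = \sum_(j < m) g (cnt (A j) n.+1).
Proof. by rewrite big_map -val_enum_ord big_map big_enum. Qed.

(** The columns of [T] have the least possible sums for their sizes.  The columns of
    [A] have the same sizes in another order and the same total sum, so that their
    sums are minimal as well. *)
Lemma top_extremal m n T A : supported m n T -> conn m T A -> top T -> tabular T ->
  perm_eq (sizes m n A) (sizes m n T) ->
  forall j v, A j v = (0 < v <= cnt (A j) n.+1).
Proof.
move=> sT c tp tT pe; have sA := conn_supported c sT.
have eT : energy m n T = energy m n A := conn_energy n c.
have colT := top_tabular_columns sT tp tT.
pose tri s := weight n (fun v => 0 < v <= s).
have eT' : energy m n T = \sum_(j < m) tri (cnt (A j) n.+1).
  rewrite -sum_sizes (perm_big _ pe) sum_sizes /energy /tri; apply: eq_bigr => j _.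
  by rewrite /weight; apply: eq_bigr => v _; rewrite -colT.
have : \sum_(j < m) (2 * tri (cnt (A j) n.+1) +
          \sum_(v < n.+1) (A j v != (0 < v <= cnt (A j) n.+1))) <= 2 * energy m n A.
  rewrite big_distrr; apply: leq_sum => j _; apply: weight_min => v /sA; lia.
rewrite big_split /= -big_distrr /= -eT' eT -[leqRHS]addn0 leq_add2l leqn0 sum_nat_eq0.
move=> /forallP h j v.
have [jm|mj] := ltnP j m; last first.
  have A0 w : A j w = false by apply/negP => /sA; lia.
  rewrite A0; have := cnt_const (N := 0) (t := n.+1) (fun w _ => A0 w) (leq0n _).
  by rewrite cnt0 => ->; lia.
have [vn|nv] := ltnP v n.+1.
  have := h (Ordinal jm); rewrite /= sum_nat_eq0 => /forallP/(_ (Ordinal vn)) /=.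
  by case: (A j v); case: (0 < v <= _).
rewrite (_ : A j v = false); last by apply/negP => /sA; lia.
have := cnt_le (A j) (ltn0Sn n).
rewrite (cntS _ 0) (_ : A j 0 = false); last by apply/negP => /sA; lia.
rewrite cnt0; lia.
Qed.

(** The extremal vectors of a component are determined by their weights. *)
Lemma extremal_unique m n T A B : supported m n T -> tabular T ->
  conn m T A -> conn m T B -> perm_eq (sizes m n A) (sizes m n T) ->
  sizes m n A = sizes m n B -> A = B.
Proof.
move=> sT tT cA cB pe eAB; have [vs [T' [lT tp]]] := lowers_exists_top sT.
have [A' [lA cA']] := conn_lowers sT cA lT.
have [B' [lB cB']] := conn_lowers sT cB lT.
have sA := conn_supported cA sT; have sB := conn_supported cB sT.
have [sT' tT' zT] := lowers_keep sT lT.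
have [sA' _ zA] := lowers_keep sA lA; have [sB' _ zB] := lowers_keep sB lB.
have ez (C D : board) : (forall k, cnt (C k) n.+1 = cnt (D k) n.+1) -> sizes m n C = sizes m n D.
  by move=> e; apply: eq_map.
suff e : A' = B' by subst B'; exact: lowers_inj lA lB.
have pA : perm_eq (sizes m n A') (sizes m n T') by rewrite (ez _ _ zA) (ez _ _ zT).
have pB : perm_eq (sizes m n B') (sizes m n T') by rewrite (ez _ _ zB) (ez _ _ zT) -eAB.
apply/funext => j; apply/funext => v.
have [jm|mj] := ltnP j m; last first.
  by apply/idP/idP => [/sA'|/sB']; lia.
rewrite (top_extremal sT' cA' tp (tT' tT) pA) (top_extremal sT' cB' tp (tT' tT) pB).
rewrite zA zB; congr (_ < _ <= _).
by have := congr1 (nth 0 ^~ j) eAB; rewrite !nth_mkseq.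
Qed.

(** * Exchanging the lengths of two adjacent columns *)

Lemma raise_exists m n i t A : supported m n A -> cnt (A i) t < cnt (A i.+1) t ->
  exists x B, i.+1 < m /\ raise i x A B.
Proof.
move=> s lt.
have Ac k u : n.+1 <= u -> cnt (A k) u = cnt (A k) n.+1.
  by move=> nu; apply: cnt_const => // v nv; apply/negP => /s; lia.
have [x xn [x1 x2]] := first_argmax (cnt (A i.+1)) (cnt (A i)) n.+1.
have pos : cnt (A i) x < cnt (A i.+1) x.
  have [tn|/ltnW nt] := leqP t n.+1; first by have := x2 t tn; lia.
  by move: lt; rewrite !(Ac _ _ nt); have := x2 n.+1 (leqnn _); lia.
case: x xn x1 x2 pos => [|x] xn x1 x2 pos; first by rewrite !cnt0 in pos.
have r : raise i x A (put (put A i x true) i.+1 x false).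
  split=> // u.
  have [un|/ltnW nu] := leqP u n.+1; first exact: x2.
  by rewrite !(Ac _ _ nu); apply: x2.
exists x; eexists; split; last exact: r.
by have [_ /s] := raise_entries r; lia.
Qed.

(** A [raise] leaves the counts up to the moved entry unchanged, and the excess just
    before that entry is one less than the maximum: hence as many [raise] are
    possible as the maximal excess. *)
Lemma raise_iter m n i k t A : supported m n A -> cnt (A i) t + k <= cnt (A i.+1) t ->
  exists B, [/\ conn m A B, cnt (B i) n.+1 = cnt (A i) n.+1 + k,
                cnt (B i.+1) n.+1 + k = cnt (A i.+1) n.+1
              & forall j, j != i -> j != i.+1 -> B j = A j].
Proof.
elim: k t A => [|k IH] t A s le.
  by exists A; rewrite !addn0; split=> //; apply: conn_refl.
have [|x [A1 [im r]]] := raise_exists (i := i) (t := t) s; first by lia.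
have [ax bx] := raise_entries r; have xn := s _ _ bx.
have s1 : supported m n A1 by apply/(raise_supported n im r).
have [|B [c e1 e2 e3]] := IH x A1 s1.
  have [_ r2 _] := r; have := r2 t; rewrite !cntS ax bx.
  by have := raise_left x r; have := raise_right x r; lia.
exists B; split.
- exact: conn_raise im r c.
- by rewrite e1; have := raise_left n.+1 r; lia.
- by have := raise_right n.+1 r; lia.
- by move=> j ji ji'; rewrite e3 // (raise_other r).
Qed.

Lemma sum_two m i (g : nat -> nat) : i.+1 < m ->
  \sum_(j < m) g j = g i + (g i.+1 + \sum_(j < m | (j != i :> nat) && (j != i.+1 :> nat)) g j).
Proof.
move=> im; have im' := ltnW im.
rewrite (bigD1 (Ordinal im')) //= (bigD1 (Ordinal im)) /=; last by rewrite -val_eqE /=; lia.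
by congr (_ + (_ + _)); apply: eq_bigl => j; rewrite -!val_eqE.
Qed.

Lemma perm_sizes_swap m n i A B : i.+1 < m ->
  cnt (B i) n.+1 = cnt (A i.+1) n.+1 -> cnt (B i.+1) n.+1 = cnt (A i) n.+1 ->
  (forall j, j != i -> j != i.+1 -> B j = A j) ->
  perm_eq (sizes m n B) (sizes m n A).
Proof.
move=> im e1 e2 e3; apply/permP => p.
rewrite -!sum1_count !(big_mkcond p) !(sum_sizes _ _ _ (fun z => if p z then 1 else 0)).
rewrite !(@sum_two m i (fun j => if p (cnt (_ j) n.+1) then 1 else 0)) // e1 e2 addnCA.
congr (_ + (_ + _)); apply: eq_bigr => j /andP[ji ji'].
by rewrite e3.
Qed.

(** Wherever two adjacent columns have increasing lengths, [raise] them as often as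
    the lengths differ, which exchanges the lengths. *)
Lemma sort_tail m n A : supported m n A ->
  exists B, [/\ conn m A B, B 0 = A 0, perm_eq (sizes m n B) (sizes m n A)
    & forall i, 0 < i -> i.+1 < m -> cnt (B i.+1) n.+1 <= cnt (B i) n.+1].
Proof.
(* Such an exchange moves the larger of two lengths to the left. *)
pose mu (A : board) := \sum_(j < m) j * cnt (A j) n.+1.
move: {2}(mu A).+1 (ltnSn (mu A)) => N; elim: N A => // N IH A muN s.
have [srt|] := pselect (forall i, 0 < i -> i.+1 < m -> cnt (A i.+1) n.+1 <= cnt (A i) n.+1).
  by exists A; split=> //; apply: conn_refl.
move=> h; have [i [i0 im lt]] : exists i, [/\ 0 < i, i.+1 < m & cnt (A i) n.+1 < cnt (A i.+1) n.+1].
  apply: contrapT => h'; apply: h => i i0 im; rewrite leqNgt; apply/negP => lt.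
  by apply: h'; exists i.
have [|B [c e1 e2 e3]] :=
    raise_iter (i := i) (t := n.+1) (k := cnt (A i.+1) n.+1 - cnt (A i) n.+1) s.
  by lia.
have {}e1 : cnt (B i) n.+1 = cnt (A i.+1) n.+1 by lia.
have {}e2 : cnt (B i.+1) n.+1 = cnt (A i) n.+1 by lia.
have [|C [cC eC pC sC]] := IH B _ (conn_supported c s).
  rewrite -ltnS; apply: leq_trans muN; rewrite ltnS /mu.
  rewrite !(@sum_two m i (fun j => j * cnt (_ j) n.+1)) // e1 e2.
  rewrite (eq_bigr (fun j : 'I_m => j * cnt (A j) n.+1)); last first.
    by move=> j /andP[ji ji']; rewrite e3.
  have hh a b z : a < b -> i * b + (i.+1 * a + z) < i * a + (i.+1 * b + z) by nia.
  exact: hh.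
exists C; split=> //; first exact: conn_trans c cC.
  by rewrite eC e3 //; lia.
exact/(perm_trans pC)/(perm_sizes_swap im e1 e2 e3).
Qed.

(** Sorting the lengths of the other columns keeps the first column, and two
    extremal boards with the same lengths in the same order are equal. *)
Lemma first_column_unique m n T A B : supported m n T -> tabular T ->
  conn m T A -> conn m T B ->
  perm_eq (sizes m n A) (sizes m n T) -> perm_eq (sizes m n B) (sizes m n T) ->
  cnt (A 0) n.+1 = cnt (B 0) n.+1 -> A 0 = B 0.
Proof.
move=> sT tT cA cB pA pB e0.
have sA := conn_supported cA sT; have sB := conn_supported cB sT.
have [A' [cA' eA pA' stA]] := sort_tail sA.
have [B' [cB' eB pB' stB]] := sort_tail sB.
have e : A' = B'; last by rewrite -eA -eB e.
apply:  (extremal_unique sT tT) => //; first exact: conn_trans cA cA'.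
- exact: conn_trans cB cB'.
- exact: perm_trans pA' pA.
have pe : perm_eq (sizes m n A') (sizes m n B').
  by rewrite (perm_trans pA') // (perm_trans pA) // perm_sym (perm_trans pB').
move: pe stA stB; rewrite /sizes /mkseq; case: m {sT cA cB pA pB sA sB cA' pA' cB' pB'} => // m.
rewrite -[iota 0 m.+1]/(0 :: iota 1 m) 2!map_cons eA eB e0 perm_cons => pe stA stB.
congr (_ :: _); apply: (sorted_eq (leT := geq)) => //.
- by move=> x y z; rewrite /= => h1 h2; apply: leq_trans h2 h1.
- by move=> x y; rewrite /= => h; apply/eqP; rewrite eqn_leq andbC.
- rewrite sorted_map; apply/(sortedP 0) => i; rewrite size_iota => im.
  by rewrite /= !nth_iota; [apply: stA| |]; lia.
- rewrite sorted_map; apply/(sortedP 0) => i; rewrite size_iota => im.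
  by rewrite /= !nth_iota; [apply: stB| |]; lia.
Qed.

Lemma cntU (c d : pred nat) t : (forall v, ~~ (c v && d v)) ->
  cnt (fun v => c v || d v) t = cnt c t + cnt d t.
Proof.
move=> cd; elim: t => [//|t IH]; rewrite !cntS IH.
by have := cd t; case: (c t); case: (d t) => //=; lia.
Qed.

Lemma cnt_below (c : pred nat) s t : cnt (fun v => c v && (v < s)) t = cnt c (minn s t).
Proof.
elim: t => [|t IH]; first by rewrite minn0.
rewrite cntS IH; have [lt|le] := ltnP t s.
  by rewrite andbT (_ : minn s t.+1 = t.+1) ?cntS //; lia.
by rewrite andbF addn0; congr (cnt _ _); lia.
Qed.

Lemma cnt_above (c : pred nat) s t :
  cnt (fun v => c v && (s <= v)) t + cnt c (minn s t) = cnt c t.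
Proof.
rewrite -cnt_below addnC -cntU.
  by apply: eq_cnt => v _; case: (c v) => //=; lia.
by move=> v; case: (c v) => //=; lia.
Qed.

(** [M] stands for the entries of column [i] which a bracketing matches with
    column [i.+1].  That no unmatched entry [x] lies inside a matched pair is
    expressed by counting: there are as many matched entries as partners below
    [x].  The unmatched entries are moved to column [i.+1] in increasing order,
    each of these moves being the inverse of a [raise]. *)
Lemma conn_swap m n i A (M : pred nat) : supported m n A -> i.+1 < m ->
  (forall v, M v -> A i v) ->
  (forall t, cnt (A i.+1) t <= cnt M t) ->
  cnt (A i.+1) n.+1 = cnt M n.+1 ->
  (forall x, A i x -> ~~ M x -> cnt M x = cnt (A i.+1) x) ->
  exists B, [/\ conn m A B, B i = M, cnt (B i.+1) n.+1 = cnt (A i) n.+1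
              & forall j, j != i -> j != i.+1 -> B j = A j].
Proof.
move=> s im MA dom tot bal.
pose R v := A i v && ~~ M v.
(* The board in which the unmatched entries below k have been moved *)
pose S k : board := fun j v => if j == i then M v || (R v && (k <= v))
  else if j == i.+1 then A i.+1 v || (R v && (v < k)) else A j v.
have ii : (i.+1 == i) = false by lia.
have RM v : R v -> M v = false by move=> /andP[_ /negbTE].
have RA v : R v -> A i.+1 v = false.
  move=> /andP[av mv]; have := bal _ av mv; have := dom v.+1; rewrite !cntS (negbTE mv).
  by case: (A i.+1 v) => //; lia.
have cl k t : cnt (S k i) t + cnt R (minn k t) = cnt M t + cnt R t.
  have -> : cnt (S k i) t = cnt M t + cnt (fun v => R v && (k <= v)) t.
    rewrite -cntU; first by apply: eq_cnt => v _; rewrite /S eqxx.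
    by move=> v; case Rv: (R v); rewrite ?andbF // RM.
  by have := cnt_above R k t; lia.
have cr k t : cnt (S k i.+1) t = cnt (A i.+1) t + cnt R (minn k t).
  rewrite -cnt_below -cntU; first by apply: eq_cnt => v _; rewrite /S ii eqxx.
  by move=> v; case Rv: (R v); rewrite ?andbF // RA.
have S0 : S 0 = A.
  apply/funext => j; apply/funext => v; rewrite /S.
  have [->|_] := eqVneq j i.
    by rewrite leq0n andbT /R; have := MA v; case: (M v) => [->|_] //=; rewrite andbT.
  by have [->|] := eqVneq j i.+1; rewrite ?ltn0 ?andbF ?orbF.
have step k : conn m A (S k).
  elim: k => [|k IH]; first by rewrite S0; apply: conn_refl.
  apply: conn_trans IH _; case Rk: (R k); last first.
    suff -> : S k.+1 = S k by apply: conn_refl.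
    apply/funext => j; apply/funext => v; rewrite /S.
    case: (eqVneq v k) => [->|vk]; first by rewrite Rk.
    have -> : (k < v) = (k <= v) by lia.
    by have -> : (v < k.+1) = (v < k) by lia.
  apply: (conn_drop im (x := k)); last exact: conn_refl.
  have [aik mk] := andP Rk; have bk := bal _ aik mk.
  split=> [t tk|t|].
  - have := cl k.+1 t; have := cl k.+1 k.+1; have := cr k.+1 t; have := cr k.+1 k.+1.
    rewrite minnn (_ : minn k.+1 t = t); last by lia.
    rewrite !(cntS _ k) Rk (RM _ Rk) (RA _ Rk).
    by have := dom t; have := cnt_mono R tk; lia.
  - have := cl k.+1 t; have := cl k.+1 k.+1; have := cr k.+1 t; have := cr k.+1 k.+1.
    rewrite minnn !(cntS _ k) Rk (RM _ Rk) (RA _ Rk).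
    have := dom t; have [le|lt] := leqP t k.+1.
      by have := cnt_mono R le; rewrite cntS Rk; lia.
    by have := cnt_mono R (ltnW lt); rewrite cntS Rk; lia.
  - apply/funext => j; apply/funext => v; rewrite /S /put.
    case: (eqVneq v k) => [->|vk]; rewrite ?andbT ?andbF.
      case: (eqVneq j i) => [->|ji].
        by rewrite (_ : (i == i.+1) = false) ?Rk ?leqnn ?orbT //; lia.
      by case: (eqVneq j i.+1) => [|] //; rewrite (RA _ Rk) ltnn andbF.
    have -> : (k < v) = (k <= v) by lia.
    by have -> : (v < k.+1) = (v < k) by lia.
exists (S n.+1); split=> //.
- apply/funext => v; rewrite /S eqxx; case Rv: (R v); last by rewrite orbF.
  by have /andP[/s] := Rv; rewrite (RM _ Rv) /=; lia.
- rewrite cr minnn; have := cl 0 n.+1; rewrite S0 min0n cnt0; lia.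
- by move=> j ji ji'; rewrite /S (negbTE ji) (negbTE ji').
Qed.

(** * Jeu de taquin slides act by column operators *)

Lemma cnt_mem (l : seq nat) t : uniq l ->
  cnt (fun v => v \in l) t = count (fun v => v < t) l.
Proof.
move=> ul; rewrite /cnt -!size_filter; apply/perm_size/uniq_perm.
- exact/filter_uniq/iota_uniq.
- exact: filter_uniq.
- by move=> v; rewrite !mem_filter mem_iota add0n /= andbC.
Qed.

Lemma count_split (p : pred nat) (f : nat -> nat) s t l : s <= t ->
  count (fun r => p r && (f r < t)) l =
  count (fun r => p r && (f r < s)) l + count (fun r => p r && (s <= f r < t)) l.
Proof. by move=> st; elim: l => //= r l ->; case: (p r) => /=; lia. Qed.

(** Fillings number their columns from 1 and boards from 0.  The bound [R] on the
    rows only serves to list the rows. *)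
Definition fboard (R : nat) (P : nat -> nat -> bool) (f : nat -> nat -> nat) : board :=
  fun j v => v \in [seq f j.+1 r | r <- iota 0 R & P j.+1 r].

Lemma fboardP R (P : nat -> nat -> bool) (f : nat -> nat -> nat) j v :
  (forall r, P j.+1 r -> r < R) ->
  reflect (exists2 r, P j.+1 r & f j.+1 r = v) (fboard R P f j v).
Proof.
move=> PR; apply: (iffP mapP) => [[r]|[r Pr e]].
  by rewrite mem_filter => /andP[Pr _] ->; exists r.
by exists r; rewrite // mem_filter Pr mem_iota /=; apply: PR.
Qed.

Lemma cnt_fboard R (P : nat -> nat -> bool) (f : nat -> nat -> nat) j t :
  (forall r s, P j.+1 r -> P j.+1 s -> f j.+1 r = f j.+1 s -> r = s) ->
  cnt (fboard R P f j) t = count (fun r => P j.+1 r && (f j.+1 r < t)) (iota 0 R).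
Proof.
move=> inj; rewrite [LHS]cnt_mem.
  by rewrite count_map count_filter; apply: eq_count => r /=; rewrite andbC.
rewrite map_inj_in_uniq; first exact/filter_uniq/iota_uniq.
by move=> r s; rewrite !mem_filter => /andP[Pr _] /andP[Ps _]; apply: inj.
Qed.

Definition boxes (inn out : nat -> nat) (j i : nat) : bool :=
  (0 < j) && (inn j < i <= out j).

Definition antitone (g : nat -> nat) : Prop := forall j k, 0 < j <= k -> g k <= g j.

(** The state of a slide: [(j, i)] is the hole.  The last two fields compare the
    neighbours of the hole with each other, which is what keeps the filling
    semistandard when one of them moves into it. *)
Record punctured (n : nat) (inn out : nat -> nat) (f : nat -> nat -> nat) (j i : nat) : Prop :=
  Punctured {
    hole_in : boxes inn out j i;
    hole_range : forall k r, boxes inn out k r -> (k, r) != (j, i) -> 0 < f k r <= n;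
    hole_row : forall k r, boxes inn out k r -> boxes inn out k.+1 r ->
      (k, r) != (j, i) -> (k.+1, r) != (j, i) -> f k r <= f k.+1 r;
    hole_col : forall k r, boxes inn out k r -> boxes inn out k r.+1 ->
      (k, r) != (j, i) -> (k, r.+1) != (j, i) -> f k r < f k r.+1;
    hole_across_row : forall k, j = k.+1 -> boxes inn out k i -> boxes inn out j.+1 i ->
      f k i <= f j.+1 i;
    hole_across_col : forall r, i = r.+1 -> boxes inn out j r -> boxes inn out j i.+1 ->
      f j r < f j i.+1
  }.

Definition filled inn out j i : nat -> nat -> bool :=
  fun k r => boxes inn out k r && ((k, r) != (j, i)).

Lemma punctured_col n inn out f j i k r s : punctured n inn out f j i ->
  filled inn out j i k r -> filled inn out j i k s -> r < s -> f k r < f k s.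
Proof.
move=> [hin _ _ hcol _ hac]; elim/ltn_ind: s => s IH /andP[br nr] /andP[bs ns] rs.
have between u : r <= u <= s -> boxes inn out k u.
  by move: br bs; rewrite /boxes; lia.
case: s rs IH bs ns between => // s rs IH bs ns between.
have [e|lt] := eqVneq r s; first by subst s; exact: hcol.
have [e|ne] := eqVneq (k, s) (j, i); last first.
  have bs' : boxes inn out k s by apply: between; lia.
  apply: ltn_trans (hcol _ _ bs' bs ne ns).
  by apply: IH; rewrite /filled ?br ?bs' //; lia.
case: e => ek es; subst k i; case: s rs IH bs ns between lt hin hac nr hcol
  => [|s] rs IH bs ns between lt hin hac nr hcol; first by lia.
have bs' : boxes inn out j s by apply: between; lia.
have lt1 : f j s < f j s.+2 by apply: hac.
have [->//|lt2] := eqVneq r s; apply: ltn_trans lt1; apply: IH; rewrite /filled ?br ?bs' //; try lia.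
by rewrite xpair_eqE; lia.
Qed.

Lemma punctured_inj n inn out f j i k r s : punctured n inn out f j i ->
  filled inn out j i k r -> filled inn out j i k s -> f k r = f k s -> r = s.
Proof.
move=> pf pr ps e; have [lt|lt|//] := ltngtP r s.
  by have := punctured_col pf pr ps lt; lia.
by have := punctured_col pf ps pr lt; lia.
Qed.

Section Slide.
Variables (n R : nat) (inn out : nat -> nat).
Hypotheses (inn_anti : antitone inn) (out_anti : antitone out).
Hypothesis (rows_lt : forall j r, boxes inn out j r -> r < R).

Let board_of f j i := fboard R (filled inn out j i) f.

Let board_ofP f j i k v :
  reflect (exists2 r, filled inn out j i k.+1 r & f k.+1 r = v) (board_of f j i k v).
Proof. by apply: fboardP => r /andP[/rows_lt]. Qed.

(** The entry [x] that moves left is the one chosen by [raise].  Above the hole, the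
    rows send the entries of column [j] injectively to entries of column [j.+1]
    that are smaller than [x], so [x] is unmatched; below the hole, they send the
    entries of column [j.+1] injectively to entries of column [j] larger than [x],
    so all these are matched. *)
Lemma punctured_right f j i : punctured n inn out f j i -> boxes inn out j.+1 i ->
  (boxes inn out j i.+1 -> f j.+1 i < f j i.+1) ->
  punctured n inn out (update f j i (f j.+1 i)) j.+1 i /\
  raise j.-1 (f j.+1 i) (board_of f j i) (board_of (update f j i (f j.+1 i)) j.+1 i).
Proof.
move=> pf bx lt; have [hin hrg hrow hcol har hac] := pf.
have ud k r y : (k, r) != (j, i) -> update f j i y k r = f k r.
  by rewrite /update xpair_eqE => /negbTE->.
have uh y : update f j i y j i = y by rewrite /update !eqxx.
split.
  split=> //.
  - move=> k r b h; have [[-> ->]|nh] := eqVneq (k, r) (j, i).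
      by rewrite uh; apply: hrg => //; rewrite xpair_eqE; lia.
    by rewrite ud //; apply: hrg.
  - move=> k r b1 b2 n1 n2; have [[e1 e2]|nh] := eqVneq (k, r) (j, i).
      by move: n2; rewrite e1 e2 eqxx.
    rewrite ud //; have [[e1 e2]|nh'] := eqVneq (k.+1, r) (j, i).
      rewrite e1 e2 uh; subst i j; exact: har.
    by rewrite ud //; apply: hrow.
  - move=> k r b1 b2 n1 n2; have [[e1 e2]|nh] := eqVneq (k, r) (j, i).
      subst k r; rewrite uh ud; first exact: lt.
      by rewrite xpair_eqE; lia.
    rewrite ud //; have [[e1 e2]|nh'] := eqVneq (k, r.+1) (j, i).
      subst k i; rewrite uh.
      have b3 : boxes inn out j.+1 r.
        by move: b1 bx; rewrite /boxes; have := inn_anti (j := j) (k := j.+1); lia.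
      apply: leq_ltn_trans (hcol _ _ b3 bx _ _); last 2 first.
      + by rewrite xpair_eqE; lia.
      + by rewrite xpair_eqE; lia.
      by apply: hrow; rewrite // xpair_eqE; lia.
    by rewrite ud //; apply: hcol.
  - move=> k [<-] b1 b2; rewrite uh ud; last by rewrite xpair_eqE; lia.
    by apply: hrow => //; rewrite xpair_eqE; lia.
  - move=> r e b1 b2; rewrite !ud; try by rewrite xpair_eqE; lia.
    subst i; apply: ltn_trans (hcol _ _ b1 bx _ _) (hcol _ _ bx b2 _ _);
      by rewrite xpair_eqE; lia.
have j0 : 0 < j by case/andP: hin.
set x := f j.+1 i.
have cA t : cnt (board_of f j i j.-1) t =
    count (fun r => filled inn out j i j r && (f j r < t)) (iota 0 R).
  rewrite [LHS]cnt_fboard (prednK j0) // => r s; exact: punctured_inj pf.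
have cB t : cnt (board_of f j i j) t =
    count (fun r => filled inn out j i j.+1 r && (f j.+1 r < t)) (iota 0 R).
  rewrite [LHS]cnt_fboard // => r s; exact: punctured_inj pf.
have fx : filled inn out j i j.+1 i by rewrite /filled bx xpair_eqE; lia.
(* Below the hole, the entries of column j are larger than x. *)
have low r : filled inn out j i j r -> i < r -> x < f j r.
  move=> fr ir; have bi : boxes inn out j i.+1 by move: hin fr; rewrite /filled /boxes; lia.
  apply: leq_trans (lt bi) _; have [<-//|ne] := eqVneq i.+1 r; apply: ltnW.
  apply: (punctured_col pf) fr _; last by lia.
  by rewrite /filled bi xpair_eqE; lia.
have c1 t : t <= x -> cnt (board_of f j i j) t + cnt (board_of f j i j.-1) x.+1
      < cnt (board_of f j i j) x.+1 + cnt (board_of f j i j.-1) t.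
  move=> tx; rewrite !cA !cB.
  rewrite (count_split (filled inn out j i j) (f j) _ (leqW tx)).
  rewrite (count_split (filled inn out j i j.+1) (f j.+1) _ (leqW tx)).
  set pa := fun r => filled inn out j i j r && (t <= f j r < x.+1).
  set pb := fun r => filled inn out j i j.+1 r && (t <= f j.+1 r < x.+1).
  suff : count pa (iota 0 R) + count (pred1 i) (iota 0 R) <= count pb (iota 0 R).
    rewrite [count (pred1 i) _]count_uniq_mem ?iota_uniq // mem_iota /=.
    by rewrite add0n (rows_lt hin); lia.
  rewrite -count_predUI (_ : count (predI pa (pred1 i)) _ = 0); last first.
    apply/eqP; rewrite -leqn0 leqNgt -has_count; apply/hasPn => r _ /=.
    by case: eqVneq => [->|]; rewrite ?andbF // /pa /filled eqxx !andbF.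
  rewrite addn0; apply: sub_count => r /= /orP[|/eqP->]; last first.
    by rewrite /pb fx /x /=; lia.
  rewrite /pa /pb => /andP[fr /andP[tf fx']].
  have ri : r < i.
    have [//|lt'|e] := ltngtP r i; first by have := low r fr lt'; lia.
    by move: fr; rewrite /filled e eqxx andbF.
  have fr' : filled inn out j i j.+1 r.
    move: fr bx; rewrite /filled /boxes !xpair_eqE.
    by have := inn_anti (j := j) (k := j.+1); lia.
  rewrite fr' /=; have := punctured_col pf fr' fx ri; rewrite -/x.
  have /andP[b1 n1] := fr; have /andP[b2 n2] := fr'.
  by have := hrow _ _ b1 b2 n1 n2; lia.
split; rewrite ?(prednK j0) //.
  move=> t; have [tx|xt] := leqP t x; first exact/ltnW/c1.
  rewrite !cA !cB.
  rewrite (count_split (filled inn out j i j) (f j) _ xt).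
  rewrite (count_split (filled inn out j i j.+1) (f j.+1) _ xt).
  rewrite -addnA leq_add2l addnC leq_add2l.
  apply: sub_count => r /= /andP[fr /andP[xf ft]].
  have ir : i < r.
    have [lt'|//|e] := ltngtP r i; last by move: xf; rewrite e -/x; lia.
    by have := punctured_col pf fr fx lt'; rewrite -/x; lia.
  have fr' : filled inn out j i j r.
    move: fr hin; rewrite /filled /boxes !xpair_eqE.
    by have := out_anti (j := j) (k := j.+1); lia.
  rewrite fr' (low _ fr' ir) /=.
  have /andP[b1 n1] := fr; have /andP[b2 n2] := fr'.
  by have := hrow _ _ b2 b1 n2 n1; lia.
apply/funext => k; apply/funext => v; rewrite /put.
have [->{k}|kj] := eqVneq k j.
  have [->{v}|vx] := eqVneq v x => /=.
    apply/board_ofP => -[r fr]; rewrite ud; last by move: fr; rewrite xpair_eqE; lia.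
    move=> e; suff er : r = i by move: fr; rewrite /filled er eqxx andbF.
    apply: (punctured_inj pf) e => //.
    by move: fr; rewrite /filled !xpair_eqE; lia.
  have -> : (j == j.-1) = false by lia.
  apply/board_ofP/board_ofP => -[r fr e]; exists r.
  - by move: fr; rewrite /filled !xpair_eqE; lia.
  - by move: e; rewrite ud // xpair_eqE; lia.
  - move: fr; rewrite /filled => /andP[-> _] /=; apply/eqP => -[er].
    by move: vx; rewrite -e er eqxx.
  - by rewrite ud // xpair_eqE; lia.
have [ek|kj'] := eqVneq k j.-1.
  have e1 : k.+1 = j by lia.
  have [->{v}|vx] := eqVneq v x => /=.
    by apply/board_ofP; exists i; rewrite e1 ?uh // /filled hin xpair_eqE; lia.
  apply/board_ofP/board_ofP; rewrite e1 => -[r fr e]; exists r.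
  - move: fr; rewrite /filled => /andP[-> _] /=; apply/eqP => -[er].
    by move: vx; rewrite -e er uh eqxx.
  - have ri : (j, r) != (j, i).
      by apply/eqP => -[er]; move: vx; rewrite -e er uh eqxx.
    by move: e; rewrite ud.
  - by move: fr; rewrite /filled !xpair_eqE; lia.
  - by rewrite ud //; case/andP: fr.
rewrite /=; apply/board_ofP/board_ofP => -[r fr e]; exists r.
- by move: fr; rewrite /filled !xpair_eqE; lia.
- by move: e; rewrite ud // xpair_eqE; lia.
- by move: fr; rewrite /filled !xpair_eqE; lia.
- by rewrite ud // xpair_eqE; lia.
Qed.

Lemma punctured_down f j i : punctured n inn out f j i -> boxes inn out j i.+1 ->
  (boxes inn out j.+1 i -> f j i.+1 <= f j.+1 i) ->
  punctured n inn out (update f j i (f j i.+1)) j i.+1 /\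
  board_of (update f j i (f j i.+1)) j i.+1 = board_of f j i.
Proof.
move=> pf bx le; have [hin hrg hrow hcol har hac] := pf.
have ud k r y : (k, r) != (j, i) -> update f j i y k r = f k r.
  by rewrite /update xpair_eqE => /negbTE->.
have uh y : update f j i y j i = y by rewrite /update !eqxx.
split.
  split=> //.
  - move=> k r b h; have [[-> ->]|nh] := eqVneq (k, r) (j, i).
      by rewrite uh; apply: hrg => //; rewrite xpair_eqE; lia.
    by rewrite ud //; apply: hrg.
  - move=> k r b1 b2 n1 n2; have [[e1 e2]|nh] := eqVneq (k, r) (j, i).
      subst k r; rewrite uh ud; first exact: le.
      by rewrite xpair_eqE; lia.
    rewrite ud //; have [[e1 e2]|nh'] := eqVneq (k.+1, r) (j, i).
      subst j r; rewrite uh.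
      have b3 : boxes inn out k i.+1.
        by move: b1 bx; rewrite /boxes; have := out_anti (j := k) (k := k.+1); lia.
      apply: ltnW; apply: leq_trans (hrow _ _ b3 bx _ _); try by rewrite xpair_eqE; lia.
      by apply: hcol; rewrite // xpair_eqE; lia.
    by rewrite ud //; apply: hrow.
  - move=> k r b1 b2 n1 n2; have [[e1 e2]|nh] := eqVneq (k, r) (j, i).
      by move: n2; rewrite e1 e2 eqxx.
    rewrite ud //; have [[e1 e2]|nh'] := eqVneq (k, r.+1) (j, i).
      by rewrite e1 e2 uh; subst k i; apply: hac.
    by rewrite ud //; apply: hcol.
  - move=> k e b1 b2; rewrite !ud; try by rewrite xpair_eqE; lia.
    subst j; apply: leq_trans (hrow _ _ b1 bx _ _) (hrow _ _ bx b2 _ _);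
      by rewrite xpair_eqE; lia.
  - move=> r [<-] b1 b2; rewrite uh ud; last by rewrite xpair_eqE; lia.
    by apply: hcol => //; rewrite xpair_eqE; lia.
apply/funext => k; apply/funext => v.
apply/board_ofP/board_ofP => -[r fr e].
  have [[e1 e2]|nh] := eqVneq (k.+1, r) (j, i).
    exists i.+1; first by rewrite /filled e1 bx xpair_eqE; lia.
    by move: e; rewrite e1 e2 uh.
  by exists r; [case/andP: fr => + _; rewrite /filled nh => -> | move: e; rewrite ud].
have [[e1 e2]|nh] := eqVneq (k.+1, r) (j, i.+1).
  exists i; first by rewrite /filled e1 hin xpair_eqE; lia.
  by rewrite e1 uh -e e1 e2.
have /andP[br nr] := fr.
by exists r; rewrite ?ud // /filled br.
Qed.

(** The boxes of the ambient shape [inn], [out] include the inner corner from which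
    the hole started, contrary to those of [S]; the hole never comes back to it. *)
Lemma hole_moves_spec (m : nat) (S : skew) f j i f' j' i' :
  hole_moves S f j i f' j' i' ->
  (forall k r, boxes inn out k r -> k <= m) ->
  (forall k r, j <= k -> i <= r -> (k, r) != (j, i) -> in_skew S k r = boxes inn out k r) ->
  punctured n inn out f j i ->
  [/\ punctured n inn out f' j' i', ~~ boxes inn out j'.+1 i', ~~ boxes inn out j' i'.+1
    & conn m (board_of f j i) (board_of f' j' i')].
Proof.
have R1 (g k r : nat) : (k.+1, r) != (k, g) by rewrite xpair_eqE; lia.
have R2 (g k r : nat) : (k, r.+1) != (g, r) by rewrite xpair_eqE; lia.
move=> hm mb; elim: hm => {f j i f' j' i'}
  [f j i s1 s2|f j i f' j' i' b c _ IH|f j i f' j' i' b c _ IH] SE pf.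
- rewrite !SE ?R1 ?R2 // in s1 s2.
  by split=> //; apply: conn_refl.
- rewrite !SE ?R1 ?R2 // in b c.
  have [pf' rs] := punctured_right pf b c.
  have [|p1 p2 p3 p4] := IH _ pf'.
    by move=> k r jk ir _; apply: SE; rewrite ?xpair_eqE; lia.
  split=> //; apply: conn_raise rs p4.
  by have := mb _ _ b; have /andP[] := hole_in pf; lia.
- rewrite !SE ?R1 ?R2 // in b c.
  have [pf' be] := punctured_down pf b c.
  have [|p1 p2 p3 p4] := IH _ pf'.
    by move=> k r jk ir _; apply: SE; rewrite ?xpair_eqE; lia.
  by split=> //; rewrite -be.
Qed.
End Slide.

Lemma hole_moves_exists S m R f j i : (forall k r, in_skew S k r -> k <= m /\ r <= R) ->
  exists f' j' i', hole_moves S f j i f' j' i'.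
Proof.
move=> bd; move: {2}((m - j) + (R - i)).+1 (ltnSn ((m - j) + (R - i))) => N.
elim: N f j i => // N IH f j i lt.
have right : in_skew S j.+1 i -> (in_skew S j i.+1 -> f j.+1 i < f j i.+1) ->
    exists f' j' i', hole_moves S f j i f' j' i'.
  move=> b c; have [|f' [j' [i' h]]] := IH (update f j i (f j.+1 i)) j.+1 i.
    by have := bd _ _ b; lia.
  by exists f', j', i'; apply: HoleRight b c h.
have down : in_skew S j i.+1 -> (in_skew S j.+1 i -> f j i.+1 <= f j.+1 i) ->
    exists f' j' i', hole_moves S f j i f' j' i'.
  move=> b c; have [|f' [j' [i' h]]] := IH (update f j i (f j i.+1)) j i.+1.
    by have := bd _ _ b; lia.
  by exists f', j', i'; apply: HoleDown b c h.
have [b1|b1] := boolP (in_skew S j.+1 i); have [b2|b2] := boolP (in_skew S j i.+1).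
- have [le|gt] := leqP (f j i.+1) (f j.+1 i); first exact: down.
  exact: right.
- by apply: right => //; rewrite (negbTE b2).
- by apply: down => //; rewrite (negbTE b1).
- by exists f, j, i; apply: HoleStops.
Qed.

Lemma sorted_geq_antitone (s : seq nat) : sorted geq s <-> antitone (nth1 s).
Proof.
split=> [srt j k jk|anti]; last first.
  by apply/(sortedP 0) => i im; have := anti i.+1 i.+2; rewrite /nth1 /=; apply; lia.
rewrite /nth1; have [ks|sk] := ltnP k.-1 (size s); last by rewrite nth_default.
have tr : transitive geq by move=> a b c; rewrite /= => h1 h2; apply: leq_trans h2 h1.
have rf : reflexive geq by move=> a; apply: leqnn.
by apply: (sorted_leq_nth tr rf 0 srt); rewrite ?inE; lia.
Qed.

Lemma nth1_decr s j k : 0 < j -> 0 < k ->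
  nth1 (decr_at s j) k = if k == j then (nth1 s j).-1 else nth1 s k.
Proof.
move=> j0 k0; rewrite /nth1 /decr_at nth_set_nth /=.
by have -> : (k.-1 == j.-1) = (k == j) by lia.
Qed.

Lemma nth1_le_sumn s j : nth1 s j <= sumn s.
Proof.
rewrite /nth1; elim: s j.-1 => [|x s IH] [|k] //=; first exact: leq_addr.
exact: leq_trans (IH k) (leq_addl _ _).
Qed.

Lemma nth1_00 s : nth1 s 0 = nth1 s 1.
Proof. by []. Qed.

Definition sboard (R : nat) (S : skew) : board := fboard R (in_skew S) (fill S).

(** Only the moves to the right change the board, each of them by one [raise].  The
    bounds on the shape and the decrease of the inner shape serve to iterate
    slides. *)
Lemma jdt_slide_spec n m R S S' : semistandard_skew n S -> jdt_slide S S' ->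
  size (outer S) <= m -> nth1 (outer S) 1 < R ->
  [/\ semistandard_skew n S', conn m (sboard R S) (sboard R S'),
      size (outer S') <= m, nth1 (outer S') 1 < R & sumn (inner S') < sumn (inner S)].
Proof.
move=> [[so si io] rg rw cl] [j [i [j' [i' [f' [[j0 i0 ei ci] hm ->]]]]]] sm oR.
have /sorted_geq_antitone out_anti := so; have /sorted_geq_antitone inn_anti := si.
pose inn := nth1 (decr_at (inner S) j); pose out := nth1 (outer S).
have innE k : 0 < k -> inn k = if k == j then i.-1 else nth1 (inner S) k.
  by move=> k0; rewrite /inn nth1_decr // -ei.
have inn'_anti : antitone inn.
  move=> k l /andP[k0 kl]; rewrite !innE; try lia.
  have := inn_anti k l; have := inn_anti j.+1 l; have := inn_anti k j.
  by case: (eqVneq l j) => [?|?]; case: (eqVneq k j) => [?|?]; try subst l; try subst k; lia.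
have SE k r : boxes inn out k r = in_skew S k r || ((k, r) == (j, i)).
  rewrite /boxes /in_skew xpair_eqE; have [k0|] := posnP k; first by subst k; lia.
  move=> k0; rewrite innE // /out; have := io j.
  by case: (eqVneq k j) => [?|?]; try subst k; lia.
have jout : boxes inn out j i by rewrite SE eqxx orbT.
have nS : ~~ in_skew S j i by rewrite /in_skew -ei ltnn /= andbF.
have fE : filled inn out j i = in_skew S.
  apply/funext => k; apply/funext => r; rewrite /filled SE.
  by case: eqVneq => [[-> ->]|_]; rewrite ?(negbTE nS) ?orbF ?andbT.
have pf : punctured n inn out (fill S) j i.
  split=> //.
  - by move=> k r; rewrite SE => /orP[/rg//|->].
  - by move=> k r; rewrite !SE => b1 b2 n1 n2; apply: rw; move: b1 b2; rewrite (negbTE n1) (negbTE n2) !orbF.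
  - by move=> k r; rewrite !SE => b1 b2 n1 n2; apply: cl; move: b1 b2; rewrite (negbTE n1) (negbTE n2) !orbF.
  - move=> k ek; subst j; rewrite !SE !xpair_eqE /in_skew.
    by have := inn_anti k k.+1; lia.
  - move=> r er; rewrite !SE !xpair_eqE /in_skew -ei; lia.
have mb k r : boxes inn out k r -> k <= m.
  move=> /andP[k0 /andP[kr rk]]; apply: leq_trans sm; rewrite leqNgt; apply/negP => lt.
  by move: rk; rewrite /out /nth1 nth_default; lia.
have rR k r : boxes inn out k r -> r < R.
  move=> /andP[k0 /andP[kr rk]]; apply: leq_ltn_trans oR; apply: leq_trans rk _.
  by apply: out_anti; lia.
have [|pf' s1 s2 cn] := hole_moves_spec inn'_anti out_anti rR hm mb _ pf.
  by move=> k r jk ir ne; rewrite SE (negbTE ne) orbF.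
rewrite -/out in pf' s1 s2 cn.
have b' := hole_in pf'; have j'0 : 0 < j' by case/andP: b'.
have eo : i' = out j'.
  by move: b' s2; rewrite /boxes; lia.
have co : out j'.+1 < i'.
  by move: b' s1; rewrite /boxes; have := inn'_anti j' j'.+1; lia.
pose out' := nth1 (decr_at (outer S) j').
have outE k : 0 < k -> out' k = if k == j' then i'.-1 else out k.
  by move=> k0; rewrite /out' nth1_decr // eo.
have S'E k r : in_skew (Skew (decr_at (outer S) j') (decr_at (inner S) j) f') k r
    = filled inn out j' i' k r.
  rewrite /in_skew /filled /boxes /= xpair_eqE -/inn -/out'.
  have [k0|k0] := posnP k; first by subst k.
  by rewrite outE //; case: (eqVneq k j') => [?|?]; try subst k; lia.
have out'_anti : antitone out'.
  move=> k l /andP[k0 kl]; rewrite !outE; try lia.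
  have := out_anti k l; have := out_anti j'.+1 l; have := out_anti k j'.
  by rewrite -/out; case: (eqVneq l j') => [?|?]; case: (eqVneq k j') => [?|?]; try subst l; try subst k; lia.
split=> //=.
- split=> /=.
  + split=> //=; try exact/sorted_geq_antitone.
    have le k : 0 < k -> inn k <= out' k.
      move=> k0; rewrite outE //; case: (eqVneq k j') => [->|_].
        by move: b'; rewrite /boxes; lia.
      by rewrite innE //; have := io k; rewrite -/out; case: (eqVneq k j) => [?|_]; try subst k; lia.
    by case=> [|k]; rewrite ?nth1_00; apply: le.
  + by move=> k r; rewrite S'E => /andP[b ne]; apply: (hole_range pf').
  + by move=> k r; rewrite !S'E => /andP[b1 n1] /andP[b2 n2]; apply: (hole_row pf').
  + by move=> k r; rewrite !S'E => /andP[b1 n1] /andP[b2 n2]; apply: (hole_col pf').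
- rewrite fE in cn; rewrite /sboard.
  have -> : in_skew (Skew (decr_at (outer S) j') (decr_at (inner S) j) f')
      = filled inn out j' i' by apply/funext => k; apply/funext => r; rewrite S'E.
  exact: cn.
- by rewrite size_set_nth; have := mb _ _ b'; lia.
- apply: leq_ltn_trans oR; rewrite -/out' outE //; have := out_anti 1 j'; rewrite -/out.
  by case: (eqVneq 1 j') => [?|?]; try subst j'; lia.
- rewrite /decr_at sumn_set_nth0 -/(nth1 (inner S) j) -ei.
  by have := nth1_le_sumn (inner S) j; rewrite -ei; lia.
Qed.

(** * Rectification and equivalence of boards *)

Definition tboard (w : seq (seq nat)) : board := fun j v => v \in nth [::] w j.

Lemma is_locE T j i : is_loc T j i = (0 < j) && (0 < i <= size (column T j)).
Proof.
rewrite /is_loc; case: (leqP j (size T)) => //= lt; rewrite andbF.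
by rewrite /column nth_default ?andbF //=; lia.
Qed.

Lemma fboard_tableau R T : (forall c, c \in T -> size c < R) ->
  fboard R (is_loc T) (entry T) = tboard T.
Proof.
move=> TR; apply/funext => j; apply/funext => v.
have bd r : is_loc T j.+1 r -> r < R.
  rewrite is_locE /column /=; have [jT|Tj] := ltnP j (size T).
    by move=> /andP[_ /leq_ltn_trans]; apply; apply: TR; apply: mem_nth.
  by rewrite nth_default //=; lia.
rewrite /tboard; apply/(fboardP _ _ bd)/(nthP 0) => [[r]|[i iT <-]].
  rewrite is_locE /entry /nth1 /column /= => br <-.
  by exists r.-1 => //; lia.
by exists i.+1; rewrite ?is_locE /entry /nth1 /column /=.
Qed.

Lemma in_skew_straight S j i : all (pred1 0) (inner S) ->
  in_skew S j i = (0 < j) && (0 < i <= nth1 (outer S) j).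
Proof.
move=> /allP z; rewrite /in_skew (_ : nth1 (inner S) j = 0) // /nth1.
have [lt|ge] := ltnP j.-1 (size (inner S)); last by rewrite nth_default.
exact/eqP/z/mem_nth.
Qed.

Lemma skew_col_lt n S j r s : semistandard_skew n S -> in_skew S j r -> in_skew S j s ->
  r < s -> fill S j r < fill S j s.
Proof.
move=> [_ _ _ cl] br; elim: s => // s IH bs; rewrite ltnS leq_eqVlt => /predU1P[e|lt].
  by subst r; apply: cl.
have bs' : in_skew S j s by move: br bs; rewrite /in_skew; lia.
exact: ltn_trans (IH bs' lt) (cl _ _ bs' bs).
Qed.

Lemma skew_col_inj n S j r s : semistandard_skew n S -> in_skew S j r -> in_skew S j s ->
  fill S j r = fill S j s -> r = s.
Proof.
move=> ss br bs e; have [lt|lt|//] := ltngtP r s.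
  by have := skew_col_lt ss br bs lt; lia.
by have := skew_col_lt ss bs br lt; lia.
Qed.

Lemma in_skew_lt n S R j r : semistandard_skew n S -> nth1 (outer S) 1 < R ->
  in_skew S j r -> r < R.
Proof.
move=> [[/sorted_geq_antitone anti _ _] _ _ _] oR /andP[j0 /andP[_ rj]].
by apply: leq_ltn_trans oR; apply: leq_trans rj _; apply: anti; lia.
Qed.

Lemma in_skew_le S m j r : size (outer S) <= m -> in_skew S j r -> j <= m.
Proof.
move=> sm /andP[j0 /andP[kr rk]]; apply: leq_trans sm; rewrite leqNgt; apply/negP => lt.
by move: rk; rewrite /nth1 nth_default; lia.
Qed.

Lemma sboard_supported n m R S : semistandard_skew n S -> size (outer S) <= m ->
  nth1 (outer S) 1 < R -> supported m n (sboard R S).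
Proof.
move=> ss sm oR j v /fboardP-/(_ (fun r => in_skew_lt ss oR))[r b <-].
have [_ rg _ _] := ss.
by rewrite rg // andbT; have := in_skew_le sm b; lia.
Qed.

Lemma sboard_tabular n R S : semistandard_skew n S -> all (pred1 0) (inner S) ->
  tabular (sboard R S).
Proof.
move=> ss z i t; rewrite !cnt_fboard; try by move=> r s; apply: (skew_col_inj ss).
apply: sub_count => r /= /andP[b lt].
have b' : in_skew S i.+1 r.
  move: b; rewrite !in_skew_straight //; have [[/sorted_geq_antitone anti _ _] _ _ _] := ss.
  by have := anti i.+1 i.+2; lia.
by rewrite b' /=; have [_ _ rw _] := ss; have := rw _ _ b' b; lia.
Qed.

Definition skew_column (S : skew) (j : nat) : seq nat :=
  [seq fill S j i | i <- iota (nth1 (inner S) j).+1 (nth1 (outer S) j - nth1 (inner S) j)].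

Lemma mem_skew_rows S j r : 0 < j ->
  (r \in iota (nth1 (inner S) j).+1 (nth1 (outer S) j - nth1 (inner S) j)) = in_skew S j r.
Proof. by move=> j0; rewrite mem_iota /in_skew; lia. Qed.

Lemma skew_column_sorted n S j : semistandard_skew n S -> 0 < j ->
  sorted ltn (skew_column S j).
Proof.
move=> ss j0; apply: (homo_sorted_in (e := ltn) (e' := ltn) (P := fun r => in_skew S j r)).
- by move=> r s br bs; apply: (skew_col_lt ss).
- by apply/allP => r; rewrite mem_skew_rows.
- exact: iota_ltn_sorted.
Qed.

Lemma sboard_column n R S j : semistandard_skew n S -> nth1 (outer S) 1 < R ->
  forall v, sboard R S j v = (v \in skew_column S j.+1).
Proof.
move=> ss oR v; apply/(fboardP _ _ (fun r => in_skew_lt ss oR))/mapP => [[r b <-]|[r]].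
  by exists r; rewrite ?mem_skew_rows.
by rewrite mem_skew_rows // => b ->; exists r.
Qed.

Lemma sboard_size n R S j : semistandard_skew n S -> nth1 (outer S) 1 < R ->
  cnt (sboard R S j) n.+1 = nth1 (outer S) j.+1 - nth1 (inner S) j.+1.
Proof.
move=> ss oR; rewrite (eq_cnt (d := fun v => v \in skew_column S j.+1)); last first.
  by move=> v _; exact: (sboard_column _ ss oR).
rewrite cnt_mem; last first.
  by apply: (sorted_uniq (leT := ltn)); [exact: ltn_trans|exact: ltnn|exact: skew_column_sorted ss _].
rewrite -[RHS](size_iota (nth1 (inner S) j.+1).+1) -[RHS](size_map (fill S j.+1)).
apply/eqP; rewrite -all_count; apply/allP => v /mapP[r].
by rewrite mem_skew_rows // => b ->; have [_ rg _ _] := ss; have := rg _ _ b; lia.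
Qed.

Lemma inner_corner_exists S : ~~ all (pred1 0) (inner S) -> exists j i, inner_corner S j i.
Proof.
move=> nz; pose P j := (0 < j) && (0 < nth1 (inner S) j).
have ex : exists j, P j.
  have /allPn[x /(nthP 0)[k ks e] x0] := nz.
  by exists k.+1; rewrite /P /nth1 /= e lt0n.
have bd j : P j -> j <= size (inner S).
  rewrite leqNgt /P; apply: contraTN => lt; rewrite /nth1 nth_default ?andbF //; lia.
case: (ex_maxnP ex bd) => j /andP[j0 ij] mx.
exists j, (nth1 (inner S) j); split=> //.
suff -> : nth1 (inner S) j.+1 = 0 by [].
by apply/eqP; rewrite -leqn0 leqNgt; apply/negP => h; have := mx j.+1; rewrite /P h; lia.
Qed.

Lemma jdt_slide_exists n m S : semistandard_skew n S -> size (outer S) <= m ->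
  ~~ all (pred1 0) (inner S) -> exists S', jdt_slide S S'.
Proof.
move=> ss sm /inner_corner_exists[j [i c]].
have [|f' [j' [i' h]]] := @hole_moves_exists S m (nth1 (outer S) 1) (fill S) j i.
  move=> k r b; split; first exact: in_skew_le sm b.
  by rewrite -ltnS; apply: (in_skew_lt ss) b.
by eexists; exists j, i, j', i', f'; split; first exact: c.
Qed.

Lemma semistandard_as_skew n (lam : n.-tuple nat) T : semistandard_tableau lam T ->
  semistandard_skew n (Skew (map size T) [::] (entry T)) /\
  in_skew (Skew (map size T) [::] (entry T)) = is_loc T.
Proof.
move=> [shape rg rw cl].
have E : in_skew (Skew (map size T) [::] (entry T)) = is_loc T.
  apply/funext => j; apply/funext => i; rewrite in_skew_straight // is_locE /nth1 /=.
  have -> // : nth 0 [seq size i | i <- T] j.-1 = size (column T j).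
  rewrite /column; have [lt|ge] := ltnP j.-1 (size T); first by rewrite (nth_map [::]).
  by rewrite !nth_default ?size_map.
split=> //; split=> /=; rewrite ?E //.
split=> //; last by move=> j; rewrite /nth1 nth_nil.
rewrite shape /col_lengths sorted_map; apply: (sub_sorted (e := ltn)); last exact: iota_ltn_sorted.
by move=> a b /= ab; apply: sub_count => m /=; lia.
Qed.

Lemma tableau_column_sorted n (lam : n.-tuple nat) T j : semistandard_tableau lam T ->
  sorted ltn (nth [::] T j).
Proof.
move=> [_ _ _ cl]; apply/(sortedP 0) => i iT; have := cl j.+1 i.+1.
by rewrite !is_locE /entry /nth1 /column /=; apply; lia.
Qed.

Lemma ltn_sorted_eq (s t : seq nat) : sorted ltn s -> sorted ltn t -> s =i t -> s = t.
Proof. exact: (irr_sorted_eq ltn_trans ltnn). Qed.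

Section Rectify.
Variables (n m R : nat) (lam : n.-tuple nat) (T : tableau).
Hypotheses (ssT : semistandard_tableau lam T) (Tm : size T <= m)
  (TR : forall c, c \in T -> size c < R).

Lemma tboard_as_sboard : tboard T = sboard R (Skew (map size T) [::] (entry T)).
Proof.
by have [_ E] := semistandard_as_skew ssT; rewrite /sboard E -(fboard_tableau TR).
Qed.

Lemma tableau_outer_lt : 0 < R -> nth1 (map size T) 1 < R.
Proof.
rewrite /nth1 /=; case: T TR => //= c T' TR' _; apply: TR'; exact: mem_head.
Qed.

Lemma tboard_supported : 0 < R -> supported m n (tboard T).
Proof.
move=> R0; rewrite tboard_as_sboard; have [ss _] := semistandard_as_skew ssT.
by apply: sboard_supported ss _ _; rewrite /= ?size_map //; apply: tableau_outer_lt.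
Qed.

Lemma tboard_tabular : tabular (tboard T).
Proof.
rewrite tboard_as_sboard; have [ss _] := semistandard_as_skew ssT.
exact: sboard_tabular ss _.
Qed.

Lemma rectifies_to_conn S : rectifies_to T S -> semistandard_skew n S ->
  size (outer S) <= m -> nth1 (outer S) 1 < R -> conn m (sboard R S) (tboard T).
Proof.
elim=> {S} [S z bE fE|S S' sl _ IH] ss sm oR; last first.
  have [ss' c sm' oR' _] := jdt_slide_spec ss sl sm oR.
  exact: conn_trans c (IH ss' sm' oR').
suff -> : sboard R S = tboard T by apply: conn_refl.
rewrite -(fboard_tableau TR) /sboard (_ : in_skew S = is_loc T); last first.
  by apply/funext => j; apply/funext => i; rewrite bE.
apply/funext => j; apply/funext => v; rewrite /fboard.
have -> // : [seq fill S j.+1 r | r <- iota 0 R & is_loc T j.+1 r]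
           = [seq entry T j.+1 r | r <- iota 0 R & is_loc T j.+1 r].
by apply/eq_in_map => r; rewrite mem_filter => /andP[b _]; apply: fE.
Qed.

(** Slides lead to some straight tableau, whose board is equivalent to that of [T];
    so it is [T], by uniqueness. *)
Lemma conn_rectifies_to S : semistandard_skew n S ->
  size (outer S) <= m -> nth1 (outer S) 1 < R -> conn m (tboard T) (sboard R S) ->
  rectifies_to T S.
Proof.
move: {2}(sumn (inner S)).+1 (ltnSn (sumn (inner S))) => N.
elim: N S => // N IH S lt ss sm oR c; have [z|nz] := boolP (all (pred1 0) (inner S)); last first.
  have [S' sl] := jdt_slide_exists ss sm nz.
  have [ss' c' sm' oR' lt'] := jdt_slide_spec ss sl sm oR.
  by apply: RectSlide sl _; apply: IH => //; [lia | apply: conn_trans c c'].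
have e : tboard T = sboard R S.
  have R0 : 0 < R by lia.
  exact: (tabular_unique (tboard_supported R0) c tboard_tabular (sboard_tabular _ ss z)).
have colE j : nth [::] T j = skew_column S j.+1.
  apply: ltn_sorted_eq (tableau_column_sorted _ ssT) (skew_column_sorted ss _) _ => // v.
  by rewrite -(sboard_column _ ss oR) -e.
have inn0 j : nth1 (inner S) j = 0.
  have [lt'|ge] := ltnP j.-1 (size (inner S)); last by rewrite /nth1 nth_default.
  by apply/eqP; move/allP: z; apply; apply: mem_nth.
have bE j i : in_skew S j i = is_loc T j i.
  rewrite is_locE in_skew_straight //; case: j => //= j.
  by rewrite /column colE size_map size_iota inn0 subn0.
apply: RectDone => // j i; rewrite is_locE; case: j => //= j b.
rewrite /entry /nth1 /column colE.
move: b; rewrite /column colE /= size_map size_iota inn0 subn0 => b.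
rewrite (nth_map 0) ?size_iota inn0 ?subn0; last by lia.
by rewrite nth_iota; [congr (fill S _ _)|]; lia.
Qed.
End Rectify.

(** * Scanning a column is matching brackets *)

Lemma max_belowP (c : seq nat) v : has (fun x => x <= v) c ->
  [/\ max_below c v \in c, max_below c v <= v &
      forall x, x \in c -> x <= v -> x <= max_below c v].
Proof.
rewrite /max_below; elim: c => //= x c IH; rewrite big_cons.
have [xv _|nxv /=] := leqP x v; last first.
  move=> /IH[m1 m2 m3]; split=> //; first by rewrite inE m1 orbT.
  by move=> y; rewrite inE => /predU1P[->|/m3//]; lia.
have [/IH[m1 m2 m3]|nh] := boolP (has (fun x => x <= v) c).
  split.
  - by rewrite /maxn; case: ifP; rewrite inE ?eqxx ?m1 ?orbT.
  - by rewrite geq_max xv.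
  - by move=> y; rewrite inE leq_max => /predU1P[->|/m3 h /h ->]; rewrite ?leqnn ?orbT.
have e : \max_(y <- c | y <= v) y = 0.
  rewrite big_seq_cond big_pred0 // => y.
  by apply: contraNF nh => /andP[yc yv]; apply/hasP; exists y.
rewrite e maxn0; split=> //; first exact: mem_head.
move=> y; rewrite inE => /predU1P[->//|yc yv].
by case/negP: nh; apply/hasP; exists y.
Qed.

Lemma max_below_mono (c : seq nat) v w : v <= w -> max_below c v <= max_below c w.
Proof.
rewrite /max_below => vw; elim: c => [|x c IH]; first by rewrite !big_nil.
rewrite !big_cons; case: (leqP x v) => xv; case: (leqP x w) => xw; rewrite ?geq_max ?leq_max ?leqnn ?IH ?orbT //.
by lia.
Qed.

Lemma ltn_nth_sorted (a : seq nat) i j : sorted ltn a -> i < size a -> j < size a ->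
  (nth 0 a i < nth 0 a j) = (i < j).
Proof.
move=> srt ia ja; have h := sorted_ltn_nth ltn_trans 0 srt.
have [lt|gt|->] := ltngtP i j; last by rewrite ltnn.
  by apply: h; rewrite ?inE.
by have := h j i ja ia gt; lia.
Qed.

Lemma mem_take_index (a : seq nat) x y : sorted ltn a -> y \in a ->
  (x \in take (index y a) a) = (x \in a) && (x < y).
Proof.
move=> srt ya; have [xa|nxa] := boolP (x \in a); last first.
  by apply: contraNF nxa; apply: mem_take.
rewrite in_take //= -{2}(nth_index 0 xa) -{2}(nth_index 0 ya).
by rewrite ltn_nth_sorted ?index_mem.
Qed.

(** The values [bs] are listed in the order of the paths, hence from the bottom of
    their column upwards; the result is listed in the same order.  Each path
    removes the entry it meets and those beneath. *)
Fixpoint match_col (a bs : seq nat) : seq nat :=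
  if bs is b :: bs' then
    let y := max_below a b in y :: match_col (take (index y a) a) bs'
  else [::].

Lemma size_match_col a bs : size (match_col a bs) = size bs.
Proof. by elim: bs a => //= b bs IH a; rewrite IH. Qed.

Lemma count_lt_all (s : seq nat) x : (forall y, y \in s -> y < x) ->
  count (fun y => y < x) s = size s.
Proof. by move=> h; apply/eqP; rewrite -all_count; apply/allP. Qed.

Lemma count_lt_uniq_sub (s a : seq nat) t : uniq s -> {subset s <= a} ->
  count (fun y => y < t) s <= count (fun y => y < t) a.
Proof.
move=> us sa; rewrite -!size_filter; apply: uniq_leq_size; first exact: filter_uniq.
by move=> x; rewrite !mem_filter => /andP[-> /sa].
Qed.

Lemma ltn_sorted_uniq (a : seq nat) : sorted ltn a -> uniq a.
Proof. exact: sorted_uniq ltn_trans ltnn a. Qed.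

Lemma gtn_sorted_uniq (a : seq nat) : sorted gtn a -> uniq a.
Proof.
apply: sorted_uniq => [y x z h1 h2|x]; last exact: ltnn.
exact: ltn_trans h2 h1.
Qed.

Lemma gtn_path_lt b (bs : seq nat) : path gtn b bs -> forall x, x \in bs -> x < b.
Proof.
by move=> p x xb; have := order_path_min (fun _ _ _ h1 h2 => ltn_trans h2 h1) p => /allP/(_ x xb).
Qed.

(** What is left of the column [a] once [m] paths have met the values [ys]: it only
    depends on the last of these, each path meeting the column above the previous
    one. *)
Definition cut (a ys : seq nat) (m : nat) : seq nat :=
  if m is m'.+1 then take (index (nth 0 ys m') a) a else a.

Lemma take_index_take (a : seq nat) k w : w \in take k a ->
  take (index w (take k a)) (take k a) = take (index w a) a.
Proof.
move=> wa; have e : index w a = index w (take k a).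
  by rewrite -{1}(cat_take_drop k a) index_cat wa.
by rewrite -e take_takel //; apply/ltnW/index_ltn.
Qed.

(** Domination ensures that each path finds an entry: the largest of the values
    [bs] is sent to the largest entry of [a] which is at most that value, and what
    is left of [a] dominates the other values.  An entry [x] that no path meets is
    larger than both the value and the entry met, or smaller than both: this is the
    condition of a bracketing expressed by the counts below [x]. *)
Lemma match_col_spec a bs : sorted ltn a -> sorted gtn bs ->
  (forall t, count (fun y => y < t) bs <= count (fun y => y < t) a) ->
  [/\ sorted gtn (match_col a bs), {subset match_col a bs <= a},
      forall t, count (fun y => y < t) bs <= count (fun y => y < t) (match_col a bs),
      forall x, x \in a -> x \notin match_col a bs ->
        count (fun y => y < x) (match_col a bs) = count (fun y => y < x) bs
    & forall m, m < size bs -> nth 0 (match_col a bs) m \in cut a (match_col a bs) m /\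
        nth 0 (match_col a bs) m = max_below (cut a (match_col a bs) m) (nth 0 bs m)].
Proof.
elim: bs a => [|b bs IH] a sa sb dom; first by split.
have bl := gtn_path_lt sb.
have hb : has (fun x => x <= b) a.
  by rewrite has_count; apply: leq_trans (dom b.+1); rewrite /= ltnSn.
have [ya yb ymax] := max_belowP hb; rewrite /=; set y := max_below a b in ya yb ymax *.
set a' := take (index y a) a.
have ma' x : (x \in a') = (x \in a) && (x < y) by apply: mem_take_index.
have ca' t : count (fun x => x < t) a' = count (fun x => x < minn t y) a.
  rewrite -!size_filter; apply/perm_size/uniq_perm.
  - exact/filter_uniq/ltn_sorted_uniq/take_sorted.
  - exact/filter_uniq/ltn_sorted_uniq.
  - by move=> x; rewrite !mem_filter ma' leq_min andbCA andbA [RHS]andbC andbA.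
have cy : count (fun x => x < b.+1) a = (count (fun x => x < y) a).+1.
  have -> : count (fun x => x < b.+1) a = count (fun x => x < y.+1) a.
    by apply: eq_in_count => x xa; rewrite !ltnS; apply/idP/idP => [/ymax->//|xy]; lia.
  have := count_split predT id a (leqnSn y); rewrite /= => ->.
  have -> : count (fun x => y <= x < y.+1) a = count (pred1 y) a.
    by apply: eq_count => x /=; lia.
  by rewrite count_uniq_mem ?ya ?addn1 //; apply: ltn_sorted_uniq.
have cb : count (fun x => x < b.+1) bs = size bs.
  by apply: count_lt_all => x /bl; lia.
have [||t|s1 s2 s3 s4 s5] := IH a'; first exact: take_sorted.
- exact: path_sorted sb.
- rewrite ca'; have := dom t; have := dom b.+1; rewrite /= cy cb ltnSn.
  have := count_size (fun x => x < t) bs.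
  by case: (leqP t y) => ty; rewrite ?(minn_idPl ty) ?(minn_idPr (ltnW ty)); lia.
split.
- rewrite /= path_sortedE; last by move=> u v w h1 h2; apply: ltn_trans h2 h1.
  by rewrite s1 andbT; apply/allP => x /s2; rewrite ma' => /andP[].
- by move=> x; rewrite inE => /predU1P[->//|/s2]; rewrite ma' => /andP[].
- by move=> t; have := s3 t; lia.
- move=> x xa; rewrite inE negb_or => /andP[xy xM].
  have [lt|gt|e] := ltngtP x y; last by rewrite e eqxx in xy.
    by rewrite s4 ?ma' ?xa //; lia.
  have bx : b < x by rewrite ltnNge; apply/negP => /(ymax _ xa); lia.
  rewrite !count_lt_all ?size_match_col ?bx //.
  + by move=> u /bl; lia.
  + by move=> u /s2; rewrite ma' => /andP[_]; lia.
- case=> [_|m]; first by split.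
  rewrite ltnS => mb; have [] := s5 m mb; suff -> : cut a (y :: match_col a' bs) m.+1
    = cut a' (match_col a' bs) m by [].
  case: m mb => // m mb; rewrite /= /a' take_index_take //.
  by apply/s2/mem_nth; rewrite size_match_col ltnW.
Qed.

(** The entries of column [l - k] met by the paths coming from column [l], columns
    being numbered from 0 and the paths starting from the bottom. *)
Fixpoint scan_to (T : tableau) (l k : nat) : seq nat :=
  if k is k'.+1 then match_col (nth [::] T (l - k)) (scan_to T l k') else rev (nth [::] T l).

Lemma size_scan_to T l k : size (scan_to T l k) = size (nth [::] T l).
Proof. by elim: k => [|k IH] /=; rewrite ?size_rev // size_match_col. Qed.

Lemma cnt_tboard n (lam : n.-tuple nat) T j t : semistandard_tableau lam T ->
  cnt (tboard T j) t = count (fun v => v < t) (nth [::] T j).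
Proof. by move=> ss; apply/cnt_mem/ltn_sorted_uniq/tableau_column_sorted/ss. Qed.

Lemma tableau_dominates n (lam : n.-tuple nat) T j t : semistandard_tableau lam T ->
  count (fun v => v < t) (nth [::] T j.+1) <= count (fun v => v < t) (nth [::] T j).
Proof.
by move=> ss; rewrite -!(cnt_tboard _ _ ss); apply: (tboard_tabular (R := (\max_(c <- T) size c).+1) ss);
  move=> c cT; rewrite ltnS; apply: leq_bigmax_seq.
Qed.

(** The entries met in a column form a subset of it, hence they are dominated by
    the column on the left, and the paths continue. *)
Lemma scan_to_spec n (lam : n.-tuple nat) T l k : semistandard_tableau lam T -> k <= l ->
  sorted gtn (scan_to T l k) /\ {subset scan_to T l k <= nth [::] T (l - k)}.
Proof.
move=> ss; elim: k => [|k IH] kl.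
  split; last by move=> x; rewrite subn0 mem_rev.
  by rewrite rev_sorted; apply: tableau_column_sorted ss.
have [s1 s2] := IH (ltnW kl).
have [||t|m1 m2 _ _ _] // := @match_col_spec (nth [::] T (l - k.+1)) (scan_to T l k).
  exact: tableau_column_sorted ss.
apply: leq_trans (count_lt_uniq_sub t (gtn_sorted_uniq s1) s2) _.
by rewrite (_ : l - k = (l - k.+1).+1) ?(tableau_dominates _ _ ss) //; lia.
Qed.

(** * The left key is obtained by scanning *)

(** Exchange the length of column [l] with those of the columns on its left, one
    after the other: it reaches column [l - k] with the entries met there. *)
Lemma scan_to_conn n (lam : n.-tuple nat) T l k : semistandard_tableau lam T ->
  l < size T -> k <= l ->
  exists A, [/\ conn (size T) (tboard T) A, A (l - k) = (fun v => v \in scan_to T l k),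
    forall j, j < l - k -> A j = tboard T j
    & perm_eq (sizes (size T) n A) (sizes (size T) n (tboard T))].
Proof.
move=> ss lT; elim: k => [|k IH] kl.
  exists (tboard T); rewrite subn0; split=> //; first exact: conn_refl.
  by apply/funext => v; rewrite /= mem_rev.
have [A [cA eA oA pA]] := IH (ltnW kl).
have [s1 s2] := scan_to_spec ss (ltnW kl).
have eS : l - k = (l - k.+1).+1 by lia.
have [||t|m1 m2 m3 m4 _] := @match_col_spec (nth [::] T (l - k.+1)) (scan_to T l k).
- exact: tableau_column_sorted ss.
- exact: s1.
- apply: leq_trans (count_lt_uniq_sub t (gtn_sorted_uniq s1) s2) _.
  by rewrite eS; apply: tableau_dominates ss.
have TR c : c \in T -> size c < (\max_(c <- T) size c).+1.
  by move=> cT; rewrite ltnS; apply: leq_bigmax_seq.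
have sT := tboard_supported ss (leqnn _) TR (ltn0Sn _).
have sA := conn_supported cA sT.
have Acol : A (l - k.+1).+1 = (fun v => v \in scan_to T l k) by rewrite -eS.
have Acol' : A (l - k.+1) = tboard T (l - k.+1) by apply: oA; lia.
have cnt_scan t : cnt (A (l - k.+1).+1) t = count (fun y => y < t) (scan_to T l k).
  by rewrite Acol; apply/cnt_mem/gtn_sorted_uniq.
have cnt_match t : cnt (fun v => v \in scan_to T l k.+1) t
    = count (fun y => y < t) (scan_to T l k.+1).
  exact/cnt_mem/gtn_sorted_uniq.
have total : cnt (A (l - k.+1).+1) n.+1 = cnt (fun v => v \in scan_to T l k.+1) n.+1.
  rewrite cnt_scan cnt_match !count_lt_all ?size_scan_to // => y.
    by move=> /m2 yT; have := sT (l - k.+1) y yT; lia.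
  by move=> yk; have := sA (l - k.+1).+1 y; rewrite Acol yk => /(_ isT); lia.
have [|v|t||x|B [cB eB zB oB]] := @conn_swap (size T) n (l - k.+1) A
    (fun v => v \in scan_to T l k.+1) sA.
- by lia.
- by rewrite Acol' => /m2.
- by rewrite cnt_scan cnt_match; apply: m3.
- exact: total.
- by rewrite Acol' cnt_scan cnt_match; apply: m4.
exists B; split.
- exact: conn_trans cA cB.
- exact: eB.
- by move=> j jl; rewrite oB ?oA //; lia.
- apply: perm_trans pA; apply: perm_sizes_swap oB; [lia | by rewrite eB total | exact: zB].
Qed.

Lemma sizes_tboard n (lam : n.-tuple nat) T : semistandard_tableau lam T ->
  sizes (size T) n (tboard T) = col_lengths lam.
Proof.
move=> ss; have [<- rg _ _] := ss.
apply: (@eq_from_nth _ 0); rewrite size_mkseq ?size_map // => j jT.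
rewrite nth_mkseq // (nth_map [::]) // (cnt_tboard _ _ ss).
apply: count_lt_all => y /(nthP 0)[i iT <-].
by have := rg j.+1 i.+1; rewrite is_locE /entry /nth1 /column /= iT => /(_ isT); lia.
Qed.

Lemma sizes_sboard n m R S : semistandard_skew n S -> nth1 (outer S) 1 < R ->
  size (outer S) = m -> sizes m n (sboard R S) = skew_col_lengths S.
Proof.
move=> ss oR sm; rewrite /skew_col_lengths sm (iotaDl 1 0) -map_comp; apply: eq_map => j /=.
by rewrite (sboard_size _ ss oR) add1n.
Qed.

(** The boards of [S] and of the exchanged columns are both equivalent to that of
    [T] and extremal, with first columns of the same length. *)
Lemma left_column_of_conn n (lam : n.-tuple nat) T l S c : semistandard_tableau lam T ->
  l < size T -> semistandard_skew n S -> rectifies_to T S ->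
  perm_eq (skew_col_lengths S) (col_lengths lam) ->
  leftmost_column S = c -> size c = size (nth [::] T l) -> c = rev (scan_to T l l).
Proof.
move=> ss lT sS rec pe ec zc.
have sm : size (outer S) = size T.
  by have [eT _ _ _] := ss; move: pe => /perm_size; rewrite -eT !size_map size_iota.
pose R := (maxn (\max_(c <- T) size c) (nth1 (outer S) 1)).+1.
have TR d : d \in T -> size d < R.
  by move=> dT; rewrite ltnS leq_max leq_bigmax_seq.
have oR : nth1 (outer S) 1 < R by rewrite ltnS leq_maxr.
have sT : supported (size T) n (tboard T) := tboard_supported ss (leqnn _) TR (ltn0Sn _).
have tT := tboard_tabular ss TR.
have cS : conn (size T) (tboard T) (sboard R S).
  by apply/conn_sym/(rectifies_to_conn TR rec sS) => //; rewrite sm.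
have [A [cA eA _ pA]] := scan_to_conn ss lT (leqnn l).
rewrite subnn in eA; have [s1 s2] := scan_to_spec ss (leqnn l).
have e0 : sboard R S 0 = A 0.
  apply: (first_column_unique sT tT cS cA _ pA).
    by rewrite (sizes_sboard sS oR sm) (sizes_tboard ss).
  rewrite (sboard_size _ sS oR) eA cnt_mem ?gtn_sorted_uniq //.
  rewrite count_lt_all ?size_scan_to -?zc -?ec ?size_map ?size_iota // => y ys.
  by have /(_ 0 y) := conn_supported cA sT; rewrite eA ys => /(_ isT); lia.
apply: ltn_sorted_eq; first by rewrite -ec; apply: skew_column_sorted sS _.
  by rewrite rev_sorted.
move=> v; rewrite mem_rev -ec -[LHS](sboard_column 0 sS oR v) e0 eA //.
Qed.

(** Each column is placed just above the previous one, so that no two boxes of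
    different columns lie in the same row. *)
Lemma skew_of_board n m A : supported m n A -> exists S,
  [/\ semistandard_skew n S, size (outer S) = m,
      skew_col_lengths S = sizes m n A
    & forall R, nth1 (outer S) 1 < R -> sboard R S = A].
Proof.
move=> sA.
pose w j := [seq v <- iota 1 n | A j v].
have mw j v : (v \in w j) = A j v.
  by rewrite mem_filter mem_iota; apply/andP/idP => [[]//|av]; split=> //; have := sA _ _ av; lia.
have wsrt j : sorted ltn (w j) by apply: sorted_filter (iota_ltn_sorted _ _); apply: ltn_trans.
have wz j : size (w j) = cnt (A j) n.+1.
  rewrite -(eq_cnt (c := fun v => v \in w j)) => [|v _]; last exact: mw.
  rewrite cnt_mem ?ltn_sorted_uniq // count_lt_all // => v; rewrite mw => /sA; lia.
pose o j := \sum_(j <= k < m) size (w k).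
have oS j : j < m -> o j = size (w j) + o j.+1 by move=> jm; rewrite /o big_ltn.
have o0 j : m <= j -> o j = 0 by move=> mj; rewrite /o big_geq.
have ole j : o j.+1 <= o j.
  by have [jm|mj] := ltnP j m; [rewrite (oS _ jm) leq_addl | rewrite !o0 //; lia].
have oanti j k : j <= k -> o k <= o j.
  by move=> /subnK <-; elim: (k - j) => // d IH; rewrite addSn; apply: leq_trans IH.
pose S := Skew (mkseq o m) (mkseq (fun j => o j.+1) m)
  (fun j i => nth 0 (w j.-1) (i - (o j).+1)).
have outE j : nth1 (outer S) j = o j.-1.
  rewrite /nth1 /=; have [jm|mj] := ltnP j.-1 m; first by rewrite nth_mkseq.
  by rewrite nth_default ?size_mkseq // o0.
have inE' j : 0 < j -> nth1 (inner S) j = o j.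
  case: j => // j _; rewrite /nth1 /=; have [jm|mj] := ltnP j m; first by rewrite nth_mkseq.
  by rewrite nth_default ?size_mkseq // o0 //; lia.
have SE j i : in_skew S j.+1 i = (o j.+1 < i <= o j) by rewrite /in_skew outE inE'.
have colE j : skew_column S j.+1 = w j.
  rewrite /skew_column outE inE' //= .
  have [jm|mj] := ltnP j m; last first.
    rewrite !o0 ?subn0 //; last by lia.
    by case: (w j) (mw j) => //= v s /(_ v); rewrite mem_head => /esym/sA; lia.
  rewrite (oS _ jm) addnK; apply: (@eq_from_nth _ 0); rewrite size_map size_iota // => i iw.
  by rewrite (nth_map 0) ?size_iota // nth_iota // addKn.
have ss : semistandard_skew n S.
  split=> //.
  - split.
    + by apply/sorted_geq_antitone => j k jk; rewrite !outE; apply: oanti; lia.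
    + by apply/sorted_geq_antitone => j k jk; rewrite !inE' ?oanti //; lia.
    + case=> [|j]; last by rewrite outE inE'.
      by rewrite nth1_00 inE' // outE.
  - case=> // j i; rewrite SE => b; have jm : j < m by (rewrite ltnNge; apply/negP => /o0; lia).
    have bd : i - (o j.+1).+1 < size (w j) by (have := oS _ jm; lia).
    by have := mem_nth 0 bd; rewrite mw => /sA; rewrite /=; lia.
  - by case=> // j i; rewrite !SE; lia.
  - case=> // j i; rewrite !SE => b1 b2 /=; have jm : j < m by (rewrite ltnNge; apply/negP => /o0; lia).
    by rewrite ltn_nth_sorted //; have := oS _ jm; lia.
exists S; split=> //.
- by rewrite size_mkseq.
- have oR : nth1 (outer S) 1 < (o 0).+1 by rewrite outE.
  have sm : size (outer S) = m by rewrite size_mkseq.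
  rewrite -(sizes_sboard ss oR sm).
  apply: eq_map => j; rewrite (sboard_size _ ss) ?outE // -wz -colE size_map size_iota.
  by rewrite outE.
- move=> R oR; apply/funext => j; apply/funext => v.
  by rewrite (sboard_column _ ss oR) colE mw.
Qed.

Lemma left_column_exists n (lam : n.-tuple nat) T l : semistandard_tableau lam T ->
  l < size T -> is_left_column lam T (size (nth [::] T l)) (rev (scan_to T l l)).
Proof.
move=> ss lT.
have TR0 d : d \in T -> size d < (\max_(c <- T) size c).+1.
  by move=> dT; rewrite ltnS leq_bigmax_seq.
have sT : supported (size T) n (tboard T) := tboard_supported ss (leqnn _) TR0 (ltn0Sn _).
have [A [cA eA _ pA]] := scan_to_conn ss lT (leqnn l).
rewrite subnn in eA.
have [S [sS sm zS bS]] := skew_of_board (conn_supported cA sT).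
pose R := (maxn (\max_(c <- T) size c) (nth1 (outer S) 1)).+1.
have TR d : d \in T -> size d < R.
  by move=> dT; rewrite ltnS leq_max leq_bigmax_seq.
have oR : nth1 (outer S) 1 < R by rewrite ltnS leq_maxr.
have rec : rectifies_to T S.
  by apply: (conn_rectifies_to ss (leqnn _) TR sS _ oR); rewrite ?sm // (bS _ oR).
have [s1 s2] := scan_to_spec ss (leqnn l).
have e : leftmost_column S = rev (scan_to T l l).
  apply: ltn_sorted_eq; first exact: skew_column_sorted sS _.
    by rewrite rev_sorted.
  by move=> v; rewrite mem_rev -[LHS](sboard_column 0 sS oR v) (bS _ oR) eA.
exists S; split=> //; first by rewrite zS -(sizes_tboard ss).
by rewrite size_rev size_scan_to.
Qed.

Theorem left_key_scan n (lam : n.-tuple nat) T l : semistandard_tableau lam T ->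
  l < size T -> nth [::] (left_key lam T) l = rev (scan_to T l l).
Proof.
move=> ss lT; have [eT _ _ _] := ss.
rewrite /left_key (nth_map 0) -eT ?size_map // (nth_map [::]) //.
apply: xget_unique; first exact: left_column_exists ss lT.
by move=> c [S [sS rec pe ec zc]]; apply: left_column_of_conn ss lT sS rec pe ec zc.
Qed.

(** * The stages of the left scanning *)

Lemma index_count_lt (a : seq nat) w : sorted ltn a -> w \in a ->
  index w a = count (fun y => y < w) a.
Proof.
move=> sa wa; have := mem_take_index _ sa wa => m.
rewrite -(@size_takel (index w a) _ a); last by apply: index_size.
rewrite -size_filter; apply/perm_size/uniq_perm.
- exact/take_uniq/ltn_sorted_uniq.
- exact/filter_uniq/ltn_sorted_uniq.
- by move=> x; rewrite m mem_filter andbC.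
Qed.

Lemma count_lt_gtn (bs : seq nat) m : sorted gtn bs -> m < size bs ->
  count (fun y => y < nth 0 bs m) bs = size bs - m.+1.
Proof.
elim: bs m => // b bs IH [|m] sb mb /=.
  by rewrite ltnn subn1 /= add0n count_lt_all //; apply: gtn_path_lt.
rewrite IH ?(path_sorted sb) //; have := gtn_path_lt sb (mem_nth 0 (mb : m < size bs)).
by move: mb; rewrite /=; lia.
Qed.

Lemma remove_beneath_cols X (r : nat -> nat) j t :
  nth [::] (remove_beneath X [seq (u.+1, (r u).+1) | u <- rev (iota 0 j)]) t
  = if t < j then take (r t) (nth [::] X t) else nth [::] X t.
Proof.
elim: j t => // j IH t; rewrite -addn1 iotaD rev_cat /= add0n nth_set_nth /= addn1.
rewrite -/(remove_beneath _ _) /column /= !IH ltnn; have [->|ne] := eqVneq t j; first by rewrite leqnn.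
by rewrite ltnS (leq_eqVlt t j) (negbTE ne).
Qed.

Lemma scan_from_cols X (w : nat -> nat) j :
  (forall t, t < j -> w t = max_below (nth [::] X t) (w t.+1)) ->
  scan_from X (w j) j = [seq (u.+1, (index (w u) (nth [::] X u)).+1) | u <- rev (iota 0 j)].
Proof.
elim: j => // j IH h; rewrite -[in RHS]addn1 iotaD rev_cat /= add0n /column /= -h //.
by rewrite IH // => t tj; apply: h; apply: leqW.
Qed.

Fixpoint scan_value (X : tableau) (v j : nat) : nat :=
  if j is j'.+1 then scan_value X (max_below (nth [::] X j') v) j' else v.

Lemma scan_value_mono X v w j : v <= w -> scan_value X v j <= scan_value X w j.
Proof. by elim: j v w => //= j IH v w vw; apply/IH/max_below_mono. Qed.

(** A path that finds no entry takes the value 0, which is then at no location.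
    This does not happen when the first entries of the columns increase weakly:
    the value taken is always at least the first entry of the next column. *)
Lemma scan_end_value X l k : 0 < l ->
  (forall t, t < l -> sorted ltn (nth [::] X t) /\ nth [::] X t <> [::]) ->
  (forall t, t.+1 < l -> head 0 (nth [::] X t) <= head 0 (nth [::] X t.+1)) ->
  0 < k <= size (column X l) ->
  scan_end X l k = scan_value X (entry X l k) l.-1.
Proof.
move=> l0 cX hX kX.
have hd t x : t < l -> x \in nth [::] X t -> head 0 (nth [::] X t) <= x.
  move=> tl; have [] := cX t tl; case: (nth [::] X t) => //= a s p _.
  rewrite inE => /predU1P[->//|xs]; apply: ltnW.
  by have := order_path_min ltn_trans p => /allP/(_ x xs).
have go j v p : j < l -> (0 < j -> head 0 (nth [::] X j.-1) <= v) ->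
    entry X p.1 p.2 = v ->
    let e := last p (scan_from X v j) in entry X e.1 e.2 = scan_value X v j.
  elim: j v p => // j IH v p jl hv ep /=; rewrite /column /=.
  have hb : has (fun x => x <= v) (nth [::] X j).
    have := hv isT; have [_] := cX j (ltnW jl).
    by case: (nth [::] X j) => //= a s _ ->.
  have [m1 m2 m3] := max_belowP hb.
  apply: IH => /=; first exact: ltnW.
    by case: j jl {hv hb m3} m1 m2 => // j jl m1 m2 _; apply: leq_trans (hX j _) (hd _ _ _ m1); lia.
  by rewrite /entry /nth1 /column /= nth_index.
rewrite /scan_end /scan_path /=; apply: go => //=; first by lia.
move=> l1; apply: leq_trans (hX l.-2 _) _; first by lia.
rewrite (_ : l.-2.+1 = l.-1); last by lia.
apply: hd; first by lia.
have kk : k.-1 < size (nth [::] X l.-1) by move: kX; rewrite /column; lia.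
exact: mem_nth.
Qed.

Lemma entry_le_top n (lam : n.-tuple nat) T l k : semistandard_tableau lam T ->
  is_loc T l k -> entry T l k <= (entry_or_top n T l k.+1).-1.
Proof.
move=> ss b; have [_ rg _ cl] := ss; rewrite /entry_or_top; case: ifP => [b'|_].
  by have := cl _ _ b b'; lia.
by have /andP[] := rg _ _ b.
Qed.

Section Stage.
Variables (n : nat) (lam : n.-tuple nat) (T : tableau) (l : nat).
Hypotheses (ss : semistandard_tableau lam T) (l0 : 0 < l) (lT : l <= size T).

Let z := size (column T l).

(* The number m of a path starts from 0, at the bottom of column l: the path from
   row k has number z - k.  Here t numbers the columns from 0. *)
Let path_value m t := nth 0 (scan_to T l.-1 (l.-1 - t)) m.
Let left_over m t := cut (nth [::] T t) (scan_to T l.-1 (l.-1 - t)) m.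

Lemma scan_to_step m t : m < z -> t < l.-1 ->
  path_value m t \in left_over m t /\ path_value m t = max_below (left_over m t) (path_value m t.+1).
Proof.
move=> mz tl; rewrite /path_value /left_over.
have e1 : l.-1 - t = (l.-1 - t.+1).+1 by lia.
have e2 : l.-1 - (l.-1 - t.+1).+1 = t by lia.
have e3 : l.-1 - (l.-1 - t.+1) = t.+1 by lia.
have [|s1 s2] := scan_to_spec (k := l.-1 - t.+1) (l := l.-1) ss; first by lia.
rewrite e3 in s2.
have [||u|_ _ _ _ h] // := @match_col_spec (nth [::] T t) (scan_to T l.-1 (l.-1 - t.+1)).
- exact: tableau_column_sorted ss.
- apply: leq_trans (count_lt_uniq_sub u (gtn_sorted_uniq s1) s2) _.
  exact: tableau_dominates ss.
- by rewrite e1 /= e2; apply: h; rewrite size_scan_to.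
Qed.

Lemma path_value_last m : m < z -> path_value m l.-1 = nth 0 (column T l) (z - m.+1).
Proof. by move=> mz; rewrite /path_value subnn /= nth_rev. Qed.

Lemma left_over_last m : m <= z -> left_over m l.-1 = take (z - m) (column T l).
Proof.
case: m => [_|m mz]; first by rewrite /left_over subnn subn0 take_size.
rewrite /left_over /= -/(path_value m l.-1) path_value_last // -/(column T l) index_uniq //.
  by rewrite -/z; lia.
exact/ltn_sorted_uniq/tableau_column_sorted/ss.
Qed.

Lemma path_value_in m t : m < z -> t < l -> path_value m t \in left_over m t.
Proof.
move=> mz tl; have [tl'|ge] := ltnP t l.-1; first by have [] := scan_to_step mz tl'.
have -> : t = l.-1 by lia.
rewrite path_value_last // left_over_last; last exact: ltnW.
have lt : z - m.+1 < size (take (z - m) (column T l)).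
  by rewrite size_takel -/z; lia.
by rewrite -(nth_take (n0 := z - m)) ?mem_nth //; lia.
Qed.

Lemma left_overS m t : m < z -> t < l ->
  left_over m.+1 t = take (index (path_value m t) (left_over m t)) (left_over m t).
Proof.
move=> mz tl; have := path_value_in mz tl; rewrite /left_over; case: m mz => [|m] mz //= pin.
by rewrite take_index_take.
Qed.

Lemma scan_path_stage X k : 0 < k <= z ->
  (forall t, t < l -> nth [::] X t = left_over (z - k) t) ->
  scan_path X l k = [seq (u.+1, (index (path_value (z - k) u) (nth [::] X u)).+1) | u <- rev (iota 0 l)]
  /\ entry X l k = path_value (z - k) l.-1.
Proof.
move=> kz eX; have kz' : z - k < z by lia.
have eL : nth [::] X l.-1 = take k (column T l).
  by rewrite eX ?left_over_last; [congr (take _ _)| |]; lia.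
have ent : entry X l k = path_value (z - k) l.-1.
  rewrite path_value_last // /entry /nth1 /column eL nth_take ?nth_take; last by lia.
  by congr (nth _ _ _); lia.
split=> //; rewrite /scan_path ent scan_from_cols; last first.
  by move=> t tl; rewrite eX; [have [] := scan_to_step kz' tl | lia].
rewrite -(prednK l0) -[in RHS](addn1 l.-1) iotaD rev_cat /= add0n (prednK l0).
congr ((_, _) :: _); rewrite eL path_value_last // (_ : z - (z - k).+1 = k.-1); last by lia.
rewrite -(nth_take (n0 := k)) ?index_uniq ?prednK //; try lia.
  by rewrite size_takel -/z; lia.
exact/take_uniq/ltn_sorted_uniq/tableau_column_sorted/ss.
Qed.

Lemma after_removals_cols m t : m <= z -> t < l ->
  nth [::] (after_removals T l m) t = left_over m t.
Proof.
elim: m t => [|m IH] t mz tl; first by rewrite /= nth_take.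
rewrite -[after_removals T l m.+1]/(remove_beneath (after_removals T l m)
  (scan_path (after_removals T l m) l (z - m))).
have [||-> _] := @scan_path_stage (after_removals T l m) (z - m); first by lia.
  by move=> u ul; rewrite IH ?subKn //; lia.
rewrite subKn; last by lia.
by rewrite remove_beneath_cols tl IH ?left_overS //; lia.
Qed.

Lemma stage_cols k t : k <= z -> t < l ->
  nth [::] (stage T l k) t = left_over (z - k) t.
Proof. by move=> kz tl; rewrite /stage -/z after_removals_cols //; lia. Qed.

Lemma left_over_head m t : m < z -> t < l ->
  [/\ sorted ltn (left_over m t), left_over m t <> [::]
    & head 0 (left_over m t) = head 0 (nth [::] T t)].
Proof.
move=> mz tl; have pin := path_value_in mz tl.
have nz : left_over m t <> [::] by move=> e; rewrite e in pin.
have srt : sorted ltn (nth [::] T t) := tableau_column_sorted _ ss.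
move: nz; rewrite /left_over; case: m mz pin => [|m] mz pin //= nz; split=> //.
  exact: take_sorted.
by move: nz; case: (index _ _) => [|i]; case: (nth [::] T t).
Qed.

Lemma head_mono t : t.+1 < size T -> head 0 (nth [::] T t) <= head 0 (nth [::] T t.+1).
Proof.
move=> tT; have [shape _ rw _] := ss.
have pos j : j < size T -> 0 < size (nth [::] T j).
  move=> jT; rewrite -(nth_map _ 0) // shape (nth_map 0) ?size_iota; last first.
    by rewrite -(size_map size) shape size_map size_iota in jT.
  rewrite nth_iota; last by rewrite -(size_map size) shape size_map size_iota in jT.
  rewrite /col_length -has_count; apply/hasP.
  have l1 : j < nth1 lam 1 by rewrite -(size_map size) shape size_map size_iota in jT.
  exists (nth1 lam 1); last by rewrite add1n.
  by apply: mem_nth; rewrite ltnNge; apply/negP => h; move: l1; rewrite /nth1 nth_default.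
have := rw t.+1 1; rewrite !is_locE /column /= !pos ?(ltnW tT) // => /(_ isT isT).
by rewrite /entry /nth1 /column /= !nth0.
Qed.

Lemma left_key_entry k : 0 < k <= z -> entry (left_key lam T) l k = path_value (z - k) 0.
Proof.
move=> kz; rewrite /entry /nth1 /column (left_key_scan ss); last by lia.
have ez : size (scan_to T l.-1 l.-1) = z by rewrite size_scan_to.
rewrite nth_rev ez; last by lia.
by rewrite /path_value subn0; congr (nth _ _ _); lia.
Qed.

Lemma scan_value_path X m j : m < z -> j <= l.-1 ->
  (forall t, t < j -> nth [::] X t = left_over m t) ->
  scan_value X (path_value m j) j = path_value m 0.
Proof.
move=> mz; elim: j => // j IH jl eX /=; rewrite eX //.
have [_ <-] := scan_to_step mz jl; apply: IH; first exact: ltnW.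
by move=> t tj; apply: eX; apply: leqW.
Qed.

(** Here [h] is the row in which the path from [(l, k)] meets column [l.-1], and
    [s] is the length of that column in the stage.  Row [h] is not above row [k]
    because the [k - 1] paths formed later meet the column at smaller entries, and
    it is bounded by [q] because the entry met there is at most [T l k]. *)
Lemma scan_row k : 1 < l -> 0 < k <= z -> exists h s,
  [/\ [/\ k <= h, h <= q_index n T l k & q_index n T l k <= s],
      g_value T l k h = entry (left_key lam T) l k,
      forall i j, 0 < i -> i <= j -> j <= s -> g_value T l k i <= g_value T l k j,
      forall i, 0 < i <= s -> (entry T l.-1 i <= entry T l k) = (i <= h)
    & forall i, is_loc (stageV T l k) l.-1 i = (0 < i <= s) /\
       (0 < i <= s -> entry (stageV T l k) l.-1 i = entry T l.-1 i)].
Proof.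
move=> l1 kz; have mz : z - k < z by lia.
set m := z - k in mz; set c := left_over m l.-2; set V := stageV T l k.
have eV t : t < l.-1 -> nth [::] V t = left_over m t.
  by move=> tl; rewrite /V /stageV nth_take // stage_cols //; lia.
have cV : column V l.-1 = c by rewrite /column eV //; lia.
have l2 : l.-2 < l by lia.
have [sc nc _] := left_over_head mz l2.
have l2' : l.-2 < l.-1 by lia.
have [wc ew] := scan_to_step mz l2'.
rewrite (_ : l.-2.+1 = l.-1) in ew; last by lia.
have eu : path_value m l.-1 = entry T l k.
  by rewrite path_value_last // /entry /nth1; congr (nth _ _ _); rewrite /m; lia.
have hb : has (fun x => x <= entry T l k) c.
  have := nc; have := left_over_head mz l2 => -[_ _ eh] _.
  have h1 : head 0 c <= entry T l k.
    rewrite eh; apply: leq_trans (head_mono _) _; first by lia.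
    rewrite (_ : l.-2.+1 = l.-1); last by lia.
    have srt : sorted ltn (nth [::] T l.-1) := tableau_column_sorted _ ss.
    have kk : k.-1 < size (nth [::] T l.-1) by move: kz; rewrite /z /column; lia.
    rewrite -nth0 /entry /nth1 /column leqNgt ltn_nth_sorted //; lia.
  by move: nc h1; rewrite -/c; case: (c) => //= a d _ ->.
set w := path_value m l.-2 in wc ew; set u := entry T l k in eu hb *.
rewrite eu -/c in ew; have [_ wu wmax] := max_belowP hb; rewrite -ew in wu wmax.
rewrite -/c in wc.
have row_le i : 0 < i <= size c -> (nth 0 c i.-1 <= u) = (i <= (index w c).+1).
  move=> ic; have i1 : i.-1 < size c by lia.
  have := ltn_nth_sorted sc (_ : index w c < size c) i1; rewrite index_mem wc nth_index // => /(_ isT) e.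
  apply/idP/idP => [le|le].
    have := wmax _ (mem_nth 0 i1) le; rewrite leqNgt e; lia.
  by apply: leq_trans _ wu; rewrite leqNgt e; lia.
have eVT i : 0 < i <= size c -> nth 0 c i.-1 = entry T l.-1 i.
  move=> ic; rewrite /entry /nth1 /column /c /left_over.
  case: (m) @c {sc nc hb wc ew wmax row_le cV} ic => [|m'] //= ic.
  by rewrite nth_take //; move: ic; rewrite size_take_min; lia.
have iz : (index w c).+1 <= size c by rewrite index_mem.
have qP : q_index n T l k <= size c /\ (index w c).+1 <= q_index n T l k.
  rewrite /q_index -/V cV; split.
    rewrite big_seq_cond; apply/bigmax_leqP_seq => i _.
    by rewrite mem_iota => /andP[]; lia.
  apply: (bigmaxn_sup_seq (index w c).+1) => //; first by rewrite mem_iota; lia.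
  rewrite /entry /nth1 cV /= nth_index //; apply: leq_trans wu _.
  by apply: (entry_le_top ss); rewrite is_locE l0 /= -/z; lia.
have [q1 q2] := qP.
have gE i : 0 < i <= size c -> g_value T l k i = scan_value V (nth 0 c i.-1) l.-2.
  move=> ic; rewrite /g_value -/V (@scan_end_value V l.-1 i); first 1 last.
  - by lia.
  - by move=> t tl; rewrite eV //; have tl' : t < l by [lia]; have [] := left_over_head mz tl'.
  - move=> t tl; have t1 : t < l by lia.
    have t2 : t.+1 < l by lia.
    rewrite !eV //; last by lia.
    have [_ _ ->] := left_over_head mz t1; have [_ _ ->] := left_over_head mz t2.
    by apply: head_mono; lia.
  - by rewrite cV.
  by rewrite /entry /nth1 cV.
exists (index w c).+1, (size c); split.
- split=> //.
  have s1 : k.-1 <= index w c.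
    have wT : w \in nth [::] T l.-2.
      by move: wc; rewrite /c /left_over; case: (m) => [|m'] //=; apply: mem_take.
    have -> : index w c = index w (nth [::] T l.-2).
      move: wc; rewrite /c /left_over; case: (m) => [|m'] //= wc'.
      by rewrite -[in RHS](cat_take_drop (index (nth 0 (scan_to T l.-1 (l.-1 - l.-2)) m') (nth [::] T l.-2)) (nth [::] T l.-2)) index_cat wc'.
    rewrite (index_count_lt (tableau_column_sorted _ ss) wT).
    have [|b1 b2] := scan_to_spec (k := l.-1 - l.-2) (l := l.-1) ss; first by lia.
    rewrite (_ : l.-1 - (l.-1 - l.-2) = l.-2) in b2; last by lia.
    apply: leq_trans (count_lt_uniq_sub w (gtn_sorted_uniq b1) b2).
    by rewrite count_lt_gtn ?size_scan_to // -/(column T l) -/z /m; lia.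
  by lia.
- rewrite gE ?(left_key_entry kz) //= nth_index //.
  rewrite -/m; apply: scan_value_path => //; first by lia.
  by move=> t tl; apply: eV; lia.
- move=> i j i0 ij jc; rewrite !gE; try lia.
  by apply: scan_value_mono; rewrite leqNgt ltn_nth_sorted //; lia.
- by move=> i ic; rewrite -eVT // row_le.
- move=> i; split; first by rewrite is_locE cV; lia.
  by move=> ic; rewrite -eVT // /entry /nth1 cV.
Qed.
End Stage.

(** * The sets F and G *)

(** The least [p] with [g_p >= Y] satisfies [p <= h] exactly when [g_h >= Y], as [g]
    is weakly increasing. *)
Lemma in_F_set n (lam sigma : n.-tuple nat) T l k : semistandard_tableau lam T ->
  is_loc T l k ->
  (entry T l k \in F_set lam T sigma l k) =
  (entry (lambda_key lam sigma) l k <= entry (left_key lam T) l k).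
Proof.
move=> ss b; have [/and4P[l0 lT k0 kz]] := (b, b) => _.
have kz' : 0 < k <= size (column T l) by rewrite k0.
have top := entry_le_top ss b.
rewrite /F_set; set Y := entry (lambda_key lam sigma) l k.
have [e|ne] := eqVneq l 1.
  rewrite inE top andbT (left_key_entry ss l0 lT kz') e subn0 /= nth_rev; last by move: kz'; rewrite e /column /=; lia.
  by rewrite /entry /nth1 /column /=; congr (_ <= nth _ _ _); move: kz'; rewrite e /column /=; lia.
have l1 : 1 < l by lia.
have [h [s [[kh hq qs] gh gm le _]]] := scan_row ss l0 lT l1 kz'.
rewrite -gh; case E : [seq _ <- _ | _] => [|p r].
  apply/esym/negP => Yh; suff : h \in [::] by [].
  by rewrite -E mem_filter Yh mem_index_iota kh ltnS.
have pr : p \in index_iota k (q_index n T l k).+1 /\ Y <= g_value T l k p.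
  have : p \in p :: r by apply: mem_head.
  by rewrite -{1}E mem_filter => /andP[].
have [/[!mem_index_iota] pk Yp] := pr.
rewrite inE top andbT le; last by lia.
apply/idP/idP => [ph|Yh].
  by apply: leq_trans Yp (gm _ _ _ ph _); lia.
have : h \in p :: r by rewrite -E mem_filter Yh mem_index_iota kh ltnS.
have srt : sorted ltn (p :: r).
  by rewrite -E; apply: sorted_filter (iota_ltn_sorted _ _); apply: ltn_trans.
rewrite inE => /predU1P[->//|hr].
by have := order_path_min ltn_trans srt => /allP/(_ h hr)/ltnW.
Qed.

(** The rows with [g = Y] form an interval from [a] to [b].  The upper bound of the
    set expresses [h <= b]: the entry in row [b + 1], if there is one, exceeds
    [T l k]. *)
Lemma in_G_set n (lam sigma : n.-tuple nat) T l k : semistandard_tableau lam T ->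
  is_loc T l k ->
  (entry T l k \in G_set lam T sigma l k) =
  (entry (lambda_key lam sigma) l k == entry (left_key lam T) l k).
Proof.
move=> ss b; have [/and4P[l0 lT k0 kz]] := (b, b) => _.
have kz' : 0 < k <= size (column T l) by rewrite k0.
have top := entry_le_top ss b.
rewrite /G_set; set Y := entry (lambda_key lam sigma) l k.
have [e|ne] := eqVneq l 1.
  rewrite inE eq_sym (left_key_entry ss l0 lT kz') e subn0 /= nth_rev; last by move: kz'; rewrite e /column /=; lia.
  by rewrite /entry /nth1 /column /=; congr (_ == nth _ _ _); move: kz'; rewrite e /column /=; lia.
have l1 : 1 < l by lia.
have [h [s [[kh hq qs] gh gm le lV]]] := scan_row ss l0 lT l1 kz'.
rewrite -gh [RHS]eq_sym; case E : [seq _ <- _ | _] => [|a r].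
  apply/esym/negP => Yh; suff : h \in [::] by [].
  by rewrite -E mem_filter Yh mem_index_iota kh ltnS.
have mem x : (x \in a :: r) = (g_value T l k x == Y) && (k <= x < (q_index n T l k).+1).
  by rewrite -E mem_filter mem_index_iota.
have srt : sorted ltn (a :: r).
  by rewrite -E; apply: sorted_filter (iota_ltn_sorted _ _); apply: ltn_trans.
have := mem a; rewrite mem_head => /esym/andP[/eqP ga ak].
have := mem (last a r); rewrite mem_last => /esym/andP[/eqP gb bk].
rewrite inE leq_min top andbT le; last by lia.
set b' := last a r in gb bk *.
have hb : (entry T l k <= (entry_or_top n (stageV T l k) l.-1 b'.+1).-1) = (h <= b').
  rewrite /entry_or_top; have [-> eV] := lV b'.+1; case: ifP => [sb|nsb].
    rewrite eV //; have := le _ sb; have [_ rg _ _] := ss.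
    have pos : 0 < entry T l k by have /andP[] := rg _ _ b.
    by rewrite /=; lia.
  by have [_ rg _ _] := ss; have := rg _ _ b; move: nsb; rewrite /=; lia.
rewrite hb; apply/andP/eqP => [[ah hb']|Yh].
  apply/eqP; rewrite eqn_leq -{1}gb -ga.
  by rewrite !gm //; lia.
have hm : h \in a :: r by rewrite mem Yh eqxx kh ltnS.
split.
  move: hm; rewrite inE => /predU1P[->//|hr].
  by have := order_path_min ltn_trans srt => /allP/(_ h hr)/ltnW.
have /(nthP 0)[i ir <-] := hm.
rewrite /b' (last_nth 0).
have [->//|ne'] := eqVneq i (size r); apply: ltnW.
by rewrite ltn_nth_sorted //; move: ir ne'; rewrite /=; lia.
Qed.

(** The shape is given by its row lengths, tableaux by their column lengths. *)
Lemma in_shape_loc n (lam : n.-tuple nat) j i : is_partition lam ->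
  in_shape lam j i = (0 < j) && (0 < i <= col_length lam j).
Proof.
move=> pl; have /sorted_geq_antitone anti := pl.
rewrite /in_shape; case: j => [|j]; first by rewrite andbF.
case: i => //= i; rewrite /col_length.
have -> : count (fun m => j.+1 <= m) lam = cnt (fun t => j < nth 0 lam t) (size lam).
  rewrite -{1}(mkseq_nth 0 lam) /mkseq count_map; exact: eq_count.
rewrite -(@down_closed (fun t => j < nth 0 lam t) (size lam)) // => t.
  by rewrite ltnNge => /negP jt; rewrite ltnNge; apply/negP => h; apply: jt; rewrite nth_default.
by have := anti t.+1 t.+2; rewrite /nth1 /= => /(_ (leqnSn _)) h1 h2; apply: leq_trans h2 h1.
Qed.

Lemma size_nth_columns n (lam : n.-tuple nat) (f : nat -> seq nat) j : is_partition lam ->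
  (forall z, z <= n -> size (f z) = z) ->
  size (column [seq f z | z <- col_lengths lam] j.+1) = col_length lam j.+1.
Proof.
move=> pl fz; rewrite /column /= /col_lengths.
have [jl|lj] := ltnP j (nth1 lam 1).
  rewrite (nth_map 0) ?size_map ?size_iota // (nth_map 0) ?size_iota // nth_iota //.
  by rewrite fz // /col_length (leq_trans (count_size _ _)) // size_tuple.
rewrite nth_default ?size_map ?size_iota //; apply/esym/eqP; rewrite -leqn0 leqNgt.
apply/negP => h; have := in_shape_loc j.+1 1 pl; rewrite h /in_shape /= => /esym; lia.
Qed.

Theorem theorem10p7 (n : nat) (lam sigma : n.-tuple nat) (T : tableau) :
  1 <= n ->
  is_partition lam ->
  is_lambda_permutation lam sigma ->
  semistandard_tableau lam T ->
  (tableau_le (lambda_key lam sigma) (left_key lam T) <->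
     forall l k : nat, in_shape lam l k -> entry T l k \in F_set lam T sigma l k)
  /\
  (lambda_key lam sigma = left_key lam T <->
     forall l k : nat, in_shape lam l k -> entry T l k \in G_set lam T sigma l k).
Proof.
move=> _ pl _ ss; have [shape _ _ _] := ss.
pose f z := sort leq (take z sigma).
have fz z : z <= n -> size (f z) = z.
  by move=> zn; rewrite size_sort size_takel // size_tuple.
have locY j i : is_loc (lambda_key lam sigma) j i = in_shape lam j i.
  by rewrite is_locE in_shape_loc //; case: j => // j; rewrite (size_nth_columns j pl fz).
have sT j : size (column T j.+1) = col_length lam j.+1.
  rewrite -(size_nth_columns (f := nseq ^~ 0) j pl) => [|z _]; last exact: size_nseq.
  rewrite -shape -map_comp /column /=; have [jT|Tj] := ltnP j (size T).
    by rewrite (nth_map [::]) //= size_nseq.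
  by rewrite !nth_default ?size_map.
have locT j i : is_loc T j i = in_shape lam j i.
  by rewrite is_locE in_shape_loc //; case: j => // j; rewrite sT.
split; split.
- by move=> le l k b; rewrite in_F_set ?locT //; apply: le; rewrite locY.
- by move=> h l k; rewrite locY => b; rewrite -in_F_set ?locT //; apply: h.
- by move=> e l k b; rewrite in_G_set ?locT // e.
move=> h; apply: (@eq_from_nth _ [::]); first by rewrite !size_map.
move=> j; rewrite size_map => jl.
have jT : j < size T by rewrite -(size_map size) shape.
have szY := size_nth_columns j pl fz; rewrite /column /= in szY.
have szL : size (nth [::] (left_key lam T) j) = col_length lam j.+1.
  by rewrite (left_key_scan ss jT) size_rev size_scan_to -sT.
apply: (@eq_from_nth _ 0) => [|i]; first by rewrite szL szY.
rewrite szY => ij; have b : in_shape lam j.+1 i.+1 by rewrite in_shape_loc.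
by have := h _ _ b; rewrite in_G_set ?locT // => /eqP.
Qed.
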